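(* For every three-qubit density matrix $\rho$ on $(\mathbb{C}^2)^{\otimes 3}$, $E_G(\rho)\le E_G(|\mathrm{W}\rangle\langle \mathrm{W}|)=\frac59$, where $|\mathrm{W}\rangle=\frac{1}{\sqrt3}(|100\rangle+|010\rangle+|001\rangle)$. That is, the W state is a maximally entangled state among all (pure or mixed) three-qubit states with respect to the geometric measure.
   Context: For a normalized pure state $|\psi\rangle$ of an $n$-partite system, $G(|\psi\rangle):=\max |\langle a_1|\cdots\langle a_n|\,\psi\rangle|$ over all normalized single-party states $|a_1\rangle,\dots,|a_n\rangle$, and $E_G(|\psi\rangle):=1-G(|\psi\rangle)^2$. For a mixed state $\rho$, $E_G(\rho):=\min\sum_i p_i E_G(|\psi_i\rangle)$, the minimum taken over all decompositions $\rho=\sum_i p_i|\psi_i\rangle\langle\psi_i|$ with $p_i\ge0$, $\sum_ip_i=1$ and normalized pure states $|\psi_i\rangle$ (convex roof). *)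

(* Defs.v *)
(* Complex scalars: an arbitrary numeric algebraically
   closed field C (e.g. algC), with conjugation z^* and modulus `|z|. *)
From HB Require Import structures.
From mathcomp Require Import all_boot all_order all_algebra.
Set Implicit Arguments. Unset Strict Implicit. Unset Printing Implicit Defensive.
Import Order.TTheory GRing.Theory Num.Theory.
Local Open Scope ring_scope.

Section Defs.
Variable C : numClosedFieldType.

(* conjugate transpose *)
Definition adjmx m n (A : 'M[C]_(m, n)) : 'M[C]_(n, m) :=
  (map_mx (fun z : C => z^*) A)^T.

(* inner product <u|v> (antilinear in u) *)
Definition braket n (u v : 'cV[C]_n) : C := \sum_(i < n) (u i 0)^* * v i 0.

Definition normalized n (v : 'cV[C]_n) : Prop := braket v v = 1.

(* index i of C^8 = C^2 (x) C^2 (x) C^2 corresponds to |i1 i2 i3>,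
   i = 4*i1 + 2*i2 + i3 *)
Definition q1 (i : 'I_8) : 'I_2 := inord ((i %/ 4) %% 2).
Definition q2 (i : 'I_8) : 'I_2 := inord ((i %/ 2) %% 2).
Definition q3 (i : 'I_8) : 'I_2 := inord (i %% 2).

(* product state |a1>|a2>|a3> *)
Definition prod3 (a1 a2 a3 : 'cV[C]_2) : 'cV[C]_8 :=
  \col_(i < 8) (a1 (q1 i) 0 * a2 (q2 i) 0 * a3 (q3 i) 0).

(* |<a1|<a2|<a3| psi>| *)
Definition overlap (psi : 'cV[C]_8) (a1 a2 a3 : 'cV[C]_2) : C :=
  `| braket (prod3 a1 a2 a3) psi |.

(* g = G(|psi>) : g is the maximum of the overlap over normalized
   single-qubit states *)
Definition IsG (psi : 'cV[C]_8) (g : C) : Prop :=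
  (exists a1 a2 a3, [/\ normalized a1, normalized a2, normalized a3
                      & overlap psi a1 a2 a3 = g]) /\
  (forall a1 a2 a3, normalized a1 -> normalized a2 -> normalized a3 ->
     overlap psi a1 a2 a3 <= g).

(* E_G(|psi>) = 1 - G(|psi>)^2 *)
Definition EGpure_val (g : C) : C := 1 - g ^+ 2.

(* projector |psi><psi| *)
Definition proj (psi : 'cV[C]_8) : 'M[C]_8 := psi *m adjmx psi.

(* a pure state decomposition rho = sum_i p_i |psi_i><psi_i| (finite) *)
Definition IsDecomp (rho : 'M[C]_8) (n : nat) (p : 'I_n -> C)
    (psi : 'I_n -> 'cV[C]_8) : Prop :=
  [/\ forall i, 0 <= p i,
      \sum_(i < n) p i = 1,
      forall i, normalized (psi i)
    & rho = \sum_(i < n) p i *: proj (psi i)].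

(* e is the average entanglement sum_i p_i E_G(|psi_i>) of some
   decomposition of rho *)
Definition DecompValue (rho : 'M[C]_8) (e : C) : Prop :=
  exists (n : nat) (p : 'I_n -> C) (psi : 'I_n -> 'cV[C]_8) (g : 'I_n -> C),
    [/\ IsDecomp rho p psi, forall i, IsG (psi i) (g i)
      & e = \sum_(i < n) p i * EGpure_val (g i)].

(* e = E_G(rho): the minimum over all decompositions (convex roof) *)
Definition IsEG (rho : 'M[C]_8) (e : C) : Prop :=
  DecompValue rho e /\ (forall e', DecompValue rho e' -> e <= e').

(* density matrix: positive semidefinite, trace one *)
Definition density (rho : 'M[C]_8) : Prop :=
  (forall v : 'cV[C]_8, 0 <= (adjmx v *m rho *m v) 0 0) /\ \tr rho = 1.

(* the W state (|100> + |010> + |001>)/sqrt 3 *)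
Definition Wstate : 'cV[C]_8 :=
  \col_(i < 8) (if (val i == 4%N) || (val i == 2%N) || (val i == 1%N)
                then (sqrtC 3)^-1 else 0).

End Defs.

(* Main.v *)
Require Import Defs.
From HB Require Import structures.
From mathcomp Require Import all_boot all_order all_algebra.
From mathcomp Require Import polyrcf ordered_qelim qe_rcf ring lra zify.
From Stdlib Require Import Classical.
Set Implicit Arguments. Unset Strict Implicit. Unset Printing Implicit Defensive.
Import Order.TTheory GRing.Theory Num.Theory.
Local Open Scope ring_scope.

(* Take a product state of maximal overlap g with psi as |000>.  Stationarity
   kills the coefficients of |001>, |010> and |100>, so psi / g is, up to a
   phase, |000> + b|011> + c|101> + d|110> + h|111>.  Contracting the first
   qubit with (z^*, 1) leaves a 2x2 matrix M with M M^* <= |z|^2 + 1, and the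
   determinant of the difference is a real quadratic polynomial in z.  Its
   nonnegativity for all z gives, with s = |b|^2 + |c|^2 + |d|^2 and p = |bcd|,
   both s + 2p <= 1 and |h|^2 <= 1 - s + 2p.  By AM-GM the first forces
   p <= 1/8, hence 1 / g^2 = 1 + s + |h|^2 <= 9/4.

   C need not be complete, so that the maximum exists is not immediate.  The
   reals of C form a real closed field; by quantifier elimination every
   definable bounded subset of the line has a least upper bound, and this is
   all that the extreme value theorem for polynomials on a bounded closed
   definable set needs.

   A density matrix is decomposed by the spectral theorem, and every
   decomposition of the projector on W only uses multiples of W. *)

(** * The real subfield of a numeric closed field *)

Section RealSubfield.
Variable C : numClosedFieldType.

Record realsub := RealSub { rval :> C; rvalP : rval \is Num.real }.

HB.instance Definition _ := [isSub for rval].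
HB.instance Definition _ := [Choice of realsub by <:].
HB.instance Definition _ := [SubChoice_isSubIntegralDomain of realsub by <:].
HB.instance Definition _ := [SubIntegralDomain_isSubField of realsub by <:].

Definition realsub_le (x y : realsub) := rval x <= rval y.
Definition realsub_lt (x y : realsub) := rval x < rval y.
Definition realsub_norm (x : realsub) := RealSub (normr_real (rval x)).

Fact realsub_le0D x y :
  realsub_le 0 x -> realsub_le 0 y -> realsub_le 0 (x + y).
Proof. exact: addr_ge0. Qed.
Fact realsub_le0M x y :
  realsub_le 0 x -> realsub_le 0 y -> realsub_le 0 (x * y).
Proof. exact: mulr_ge0. Qed.
Fact realsub_le0_anti x : realsub_le 0 x -> realsub_le x 0 -> x = 0.
Proof. by move=> x0 x0'; apply/val_inj/le_anti/andP; split. Qed.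
Fact realsub_sub_ge0 x y : realsub_le 0 (y - x) = realsub_le x y.
Proof. exact: subr_ge0. Qed.
Fact realsub_le0_total x : realsub_le 0 x || realsub_le x 0.
Proof. exact: rvalP. Qed.
Fact realsub_normN x : realsub_norm (- x) = realsub_norm x.
Proof. exact/val_inj/normrN. Qed.
Fact realsub_ge0_norm x : realsub_le 0 x -> realsub_norm x = x.
Proof. by move=> x0; apply/val_inj/ger0_norm. Qed.
Fact realsub_lt_def x y : realsub_lt x y = (y != x) && realsub_le x y.
Proof. exact: lt_def. Qed.

HB.instance Definition _ := Num.IntegralDomain_isLeReal.Build realsub
  realsub_le0D realsub_le0M realsub_le0_anti realsub_sub_ge0
  realsub_le0_total realsub_normN realsub_ge0_norm realsub_lt_def.

Fact rval_zmod_morphism : zmod_morphism rval. Proof. by []. Qed.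
Fact rval_monoid_morphism : monoid_morphism rval. Proof. by []. Qed.
HB.instance Definition _ :=
  GRing.isZmodMorphism.Build realsub C rval rval_zmod_morphism.
HB.instance Definition _ :=
  GRing.isMonoidMorphism.Build realsub C rval rval_monoid_morphism.

Definition re (z : C) : realsub := RealSub (Creal_Re z).
Definition im (z : C) : realsub := RealSub (Creal_Im z).

Lemma re_im z : z = val (re z) + 'i * val (im z).
Proof. exact: Crect. Qed.

(** Induction on the degree, splitting off a root in [C]. A real root lies outside [a, b], so its
    linear factor has the same sign at both ends. A nonreal root comes with its conjugate, and the
    two together form a real quadratic that is positive everywhere. *)
Lemma noroot_mul_gt0 (p : {poly realsub}) (a b : realsub) : a <= b ->
  (forall x, a <= x <= b -> ~~ root p x) -> 0 < p.[a] * p.[b].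
Proof.
move=> leab; move: {2}(size p) (leqnn (size p)) => n.
elim: n p => [|n IHn] p.
  rewrite leqn0 size_poly_eq0 => /eqP-> /(_ a).
  by rewrite lexx leab root0; move/(_ isT).
move=> szp nor.
have [sz1|sz1] := leqP (size p) 1.
  have [c pc] : exists c, p = c%:P by exists p`_0; exact: size1_polyC.
  have := nor a; rewrite lexx leab pc !hornerC => /(_ isT).
  by rewrite rootE hornerC => c0; rewrite -expr2 lt0r sqr_ge0 expf_neq0.
have p0 : p != 0 by rewrite -size_poly_gt0; exact: ltn_trans sz1.
pose pC := map_poly rval p.
have /closed_rootP[z rz] : size pC != 1%N.
  by rewrite size_map_poly; case: (size p) sz1 => [|[]].
have [zR|zNR] := boolP (z \is Num.real).
  pose x := RealSub zR.
  have rx : root p x by rewrite -(fmorph_root (rval : {rmorphism _ -> _})).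
  have /factor_theorem[q pq] := rx.
  have q0 : q != 0 by apply: contraNneq p0 => q0; rewrite pq q0 mul0r.
  have {}IHn : 0 < q.[a] * q.[b].
    apply: IHn => [|y yab].
      by move: szp; rewrite pq size_mul ?polyXsubC_eq0 // size_XsubC addn2 ltnS.
    by have := nor y yab; rewrite pq rootM negb_or => /andP[].
  rewrite pq !hornerM !hornerXsubC mulrACA mulr_gt0 //.
  have := nor x; rewrite rx => /contraL /(_ isT).
  by rewrite negb_and -!ltNge => /orP[] h; nra.
have rzc : root pC z^*.
  have -> : pC = map_poly Num.conj pC.
    by apply/polyP=> i; rewrite !coef_map /= conj_Creal ?rvalP.
  by rewrite fmorph_root.
pose m : {poly realsub} := 'X^2 - (re z *+ 2) *: 'X + (re z ^+ 2 + im z ^+ 2)%:P.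
have zzc : z^* = val (re z) - 'i * val (im z).
  by rewrite {1}(re_im z) rmorphD rmorphM /= conjCi !conj_Creal ?rvalP // mulNr.
have mC : map_poly rval m = ('X - z%:P) * ('X - (z^*)%:P).
  rewrite /m rmorphD rmorphB /= map_polyXn map_polyZ map_polyX map_polyC.
  rewrite zzc [X in 'X - X%:P](re_im z) -!mul_polyC.
  rewrite [X in X%:P * 'X]rmorphMn [X in _ + X%:P]rmorphD !rmorphXn /=.
  set r := 'Re z; set s := 'Im z.
  rewrite mulr2n !rmorphD rmorphN rmorphM !rmorphXn /=.
  have ii : ('i : C)%:P * 'i%:P = -1 by rewrite -rmorphM -expr2 sqrCi rmorphN.
  set i' := ('i)%:P in ii *.
  apply/eqP; rewrite -subr_eq0; set u := (X in X == 0).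
  (* [ring] treats [i'] as an indeterminate, so the relation i^2 = -1 enters through an explicit
     multiple of [i' * i' + 1]. *)
  have -> : u = (i' * i' + 1) * s%:P ^+ 2 by rewrite /u; ring.
  by rewrite ii addNr mul0r.
have mp : m %| p.
  rewrite -(dvdp_map (rval : {rmorphism _ -> _})) mC.
  have := @uniq_roots_dvdp C pC [:: z; z^*].
  rewrite big_cons big_seq1; apply; first by rewrite /= rz rzc.
  rewrite uniq_rootsE /= andbT inE.
  by apply: contraNN zNR => /eqP zz; apply/CrealP.
have /dvdpP[q pq] := mp.
have q0 : q != 0 by apply: contraNneq p0 => q0; rewrite pq q0 mul0r.
have m0 : m != 0 by apply: contraNneq p0 => m0; rewrite pq m0 mulr0.
have szm : size m = 3%N.
  rewrite -(size_map_poly (rval : {rmorphism _ -> _})) mC.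
  by rewrite size_mul ?polyXsubC_eq0 // !size_XsubC.
have mpos y : 0 < m.[y].
  have -> : m.[y] = (y - re z) ^+ 2 + im z ^+ 2 by rewrite /m !hornerE /=; ring.
  have : im z != 0.
    by apply: contraNneq zNR => /(congr1 val) /= /eqP h; apply/Creal_ImP/eqP.
  move=> i0; have : 0 < im z ^+ 2 by rewrite lt0r sqr_ge0 expf_neq0.
  by have := sqr_ge0 (y - re z); lra.
rewrite pq !hornerM mulrACA; apply: mulr_gt0; last by rewrite mulr_gt0.
apply: IHn => [|y yab].
  move: szp; rewrite pq size_mul // szm addn3 /= => /ltnW; exact.
by have := nor y yab; rewrite pq rootM negb_or => /andP[].
Qed.

(** The finite list [rs] of roots in [C] is searched for a real one in [a, b]. If there is none, p
    has the same strict sign at a and b, against p(a) <= 0 <= p(b). *)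
Fact realsub_ivt : Num.real_closed_axiom realsub.
Proof.
move=> p a b leab /andP[pa pb].
have [->|p0] := eqVneq p 0; first by exists a; rewrite ?lexx ?root0.
have pC0 : map_poly rval p != 0 by rewrite map_poly_eq0.
have [rs prs] := closed_field_poly_normal (map_poly rval p).
have rsP x : root p x = (val x \in rs).
  rewrite -(fmorph_root (rval : {rmorphism _ -> _})) prs rootZ ?lead_coef_eq0 //.
  by rewrite root_prod_XsubC.
have [/hasP[z zrs /and3P[zR az zb]]|/hasPn nor] :=
  boolP (has (fun z => [&& z \is Num.real, val a <= z & z <= val b]) rs).
  by exists (RealSub zR); [apply/andP; split | rewrite rsP].
have /(noroot_mul_gt0 leab) : forall x, a <= x <= b -> ~~ root p x.
  move=> x /andP[ax xb]; rewrite rsP; apply/negP => /nor.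
  by rewrite rvalP /= negb_and; case/orP => /negP; apply.
by move=> h; exfalso; move: h; rewrite ltNge => /negP; apply; nra.
Qed.
HB.instance Definition _ := Num.RealField_isClosed.Build realsub realsub_ivt.

End RealSubfield.

(** * Suprema of definable sets *)

Section Definable.
Variable R : rcfType.
Implicit Types (e : seq R) (P : seq R -> Prop) (U : R -> Prop).

(** One-variable o-minimality: membership can change only at the finitely many roots of [p], so [U]
    is a finite union of points and intervals. *)
Definition tame U := exists2 p : {poly R}, p != 0 &
  forall x y : R, x < y -> (forall z : R, x <= z <= y -> ~~ root p z) -> U x <-> U y.

Definition is_lub U s :=
  (forall x, U x -> x <= s) /\ (forall b, (forall x, U x -> x <= b) -> s <= b).

(* A root in [x, b], where x is in U and b bounds U, either is the supremum or
   can be avoided by moving x up or b down: induct on the number of roots. *)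
Lemma tame_lub U : tame U -> (exists x, U x) ->
  (exists b, forall x, U x -> x <= b) -> exists s, is_lub U s.
Proof.
move=> [p p0 Up] [x Ux] [b Ub].
have : forall z, x <= z <= b -> root p z -> z \in rootsR p.
  by move=> z _ rz; rewrite -(roots_on_rootsR p0) rz inE.
move: {2}(size (rootsR p)) (leqnn (size (rootsR p))) => n.
elim: n (rootsR p) x b Ux Ub => [|n IHn] s x b Ux Ub szs sP.
  have xb := Ub _ Ux; move: xb; rewrite le_eqVlt => /orP[/eqP xb|xb].
    by exists x; split=> [y /Ub|c]; [rewrite xb | exact].
  have [h _] : U x <-> U b.
    apply: Up => // z xzb; apply/negP => /(sP _ xzb).
    by move: szs; rewrite leqn0 size_eq0 => /eqP->.
  by exists b; split=> // c; apply; exact: h.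
have xb := Ub _ Ux; move: xb; rewrite le_eqVlt => /orP[/eqP xb|xb].
  by exists x; split=> [y /Ub|c]; [rewrite xb | exact].
have [[r /andP[xrb rr]]|nor] :=
    classic (exists r, (x <= r <= b) && root p r); last first.
  have [h _] : U x <-> U b.
    by apply: Up => // z xzb; apply/negP => rz; apply: nor; exists z; rewrite xzb.
  by exists b; split=> // c; apply; exact: h.
have rs := sP _ xrb rr.
have IH y c : U y -> (forall z, U z -> z <= c) -> x <= y -> c <= b ->
    ~~ (y <= r <= c) -> exists s0, is_lub U s0.
  move=> Uy Uc xy cb ncr; apply: (IHn (rem r s) y c) => //.
    by rewrite size_rem // -ltnS prednK // -has_predT; apply/hasP; exists r.
  move=> z /andP[yz zc] rz; have zs : z \in s.
    by apply: sP => //; rewrite (le_trans xy yz) (le_trans zc cb).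
  move: zs; rewrite (perm_mem (perm_to_rem rs)) inE => /orP[/eqP zr|//].
  by move: ncr; rewrite -zr yz zc.
have [[u [Uu ru]]|nou] := classic (exists u, U u /\ r < u).
  apply: (IH u b) => //; last by rewrite (lt_geF ru).
  by apply: ltW; apply: le_lt_trans ru; case/andP: xrb.
have [[c [xcr Uc]]|noc] :=
    classic (exists c, c < r /\ forall z, U z -> z <= c).
  apply: (IH x c) => //; last by rewrite (lt_geF xcr) andbF.
  by apply: ltW; apply: (lt_le_trans xcr); case/andP: xrb.
exists r; split=> [z Uz|c Uc]; rewrite leNgt; apply/negP => lt.
  by apply: nou; exists z.
by apply: noc; exists c.
Qed.

Lemma tameC (b : bool) : tame (fun _ => b).
Proof. by exists 1; rewrite ?oner_neq0. Qed.

(** The hypothesis on [W] covers every Boolean connective; the product polynomial collects the roots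
    of both witnesses. *)
Lemma tame2 U V W : tame U -> tame V ->
  (forall x y, (U x <-> U y) -> (V x <-> V y) -> (W x <-> W y)) -> tame W.
Proof.
move=> [p p0 Up] [q q0 Vq] UVW; exists (p * q); first by rewrite mulf_neq0.
move=> x y xy h; apply: UVW; [apply: Up | apply: Vq] => // z /h;
by rewrite rootM negb_or => /andP[].
Qed.

Lemma tame_sign (U : R -> Prop) p :
  (forall x y, Num.sg p.[x] = Num.sg p.[y] -> U x -> U y) -> tame U.
Proof.
move=> Up; have [p0|p0] := eqVneq p 0.
  exists 1; rewrite ?oner_neq0 // => x y _ _.
  by split; apply: Up; rewrite p0 !horner0.
exists p => // x y xy nor.
suff sg : Num.sg p.[x] = Num.sg p.[y] by split; apply: Up.
have : 0 < p.[x] * p.[y].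
  rewrite ltNge; apply/negP => /(polyrcf.poly_ivt (ltW xy))[z zxy rz].
  by move: zxy; rewrite in_itv /= => /nor; rewrite rz.
by rewrite -sgr_gt0 sgrM; do 2 case: sgrP => _; rewrite ?mul0r ?mulr0 ?mulN1r ?mulrN1; lra.
Qed.

(** With all variables but the k-th frozen at [e], a term without inverses is a polynomial in one
    variable. *)
Lemma term_horner e k (t : GRing.term R) : GRing.rterm t ->
  exists p : {poly R}, forall x, p.[x] = GRing.eval (set_nth 0 e k x) t.
Proof.
elim: t => //=.
- move=> i _; have [->|ik] := eqVneq i k.
    by exists 'X => x; rewrite hornerX nth_set_nth /= eqxx.
  by exists (e`_i)%:P => x; rewrite hornerC nth_set_nth /= (negPf ik).
- by move=> c _; exists c%:P => x; rewrite hornerC.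
- by move=> n _; exists n%:R%:P => x; rewrite hornerC.
- move=> t1 IH1 t2 IH2 /andP[/IH1[p pE] /IH2[q qE]].
  by exists (p + q) => x; rewrite hornerD pE qE.
- by move=> t IH /IH[p pE]; exists (- p) => x; rewrite hornerN pE.
- by move=> t IH n /IH[p pE]; exists (p *+ n) => x; rewrite hornerMn pE.
- move=> t1 IH1 t2 IH2 /andP[/IH1[p pE] /IH2[q qE]].
  by exists (p * q) => x; rewrite hornerM pE qE.
- by move=> t IH n /IH[p pE]; exists (p ^+ n) => x; rewrite horner_exp pE.
Qed.

Lemma tame_qf e k f : ord.qf_form f -> ord.rformula f ->
  tame (fun x => ord.qf_eval (set_nth 0 e k x) f).
Proof.
elim: f => //=.
- by move=> b _ _; exact: tameC.
- move=> t1 t2 _ /andP[/(term_horner e k)[p pE] /(term_horner e k)[q qE]].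
  apply: (@tame_sign _ (q - p)) => x y; rewrite -!pE -!qE !hornerE /= => sg.
  by rewrite eq_sym -subr_eq0 -sgr_eq0 sg sgr_eq0 subr_eq0 eq_sym.
- move=> t1 t2 _ /andP[/(term_horner e k)[p pE] /(term_horner e k)[q qE]].
  apply: (@tame_sign _ (q - p)) => x y; rewrite -!pE -!qE !hornerE /= => sg.
  by rewrite -subr_gt0 -sgr_gt0 sg sgr_gt0 subr_gt0.
- move=> t1 t2 _ /andP[/(term_horner e k)[p pE] /(term_horner e k)[q qE]].
  apply: (@tame_sign _ (q - p)) => x y; rewrite -!pE -!qE !hornerE /= => sg.
  by rewrite -subr_ge0 -sgr_ge0 sg sgr_ge0 subr_ge0.
- move=> f IHf g IHg /andP[qf qg] /andP[rf rg].
  by apply: (tame2 (IHf qf rf) (IHg qg rg)) => x y [h1 h2] [h3 h4];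
    split=> /andP[*]; apply/andP; split; auto.
- move=> f IHf g IHg /andP[qf qg] /andP[rf rg].
  by apply: (tame2 (IHf qf rf) (IHg qg rg)) => x y [h1 h2] [h3 h4];
    split=> /orP[] ?; apply/orP; auto.
- move=> f IHf g IHg /andP[qf qg] /andP[rf rg].
  by apply: (tame2 (IHf qf rf) (IHg qg rg)) => x y [h1 h2] [h3 h4];
    split=> /implyP ?; apply/implyP; auto.
- move=> f IHf qf rf.
  by apply: (tame2 (IHf qf rf) (IHf qf rf)) => x y [h1 h2] _;
    split=> /negP ?; apply/negP; auto.
Qed.

Definition definable P :=
  exists f : ord.formula R, forall e, ord.holds e f <-> P e.

(** Removing inverses and then eliminating quantifiers leaves a quantifier-free formula, whose atoms
    are sign conditions on polynomials in the k-th variable. *)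
Lemma definable_tame e k P : definable P -> tame (fun x => P (set_nth 0 e k x)).
Proof.
move=> [f fP]; pose g := ord.quantifier_elim (@wproj R) (ord.to_rform f).
have /andP[qg rg] : ord.qf_form g && ord.rformula g.
  by apply: ord.quantifier_elim_wf (ord.to_rform_rformula f); exact: wf_QE_wproj.
have gP e' : ord.qf_eval e' g <-> P e'.
  rewrite -fP -ord.to_rformP; apply: iff_sym; apply: rwP.
  apply: ord.quantifier_elim_rformP (ord.to_rform_rformula f).
    exact: wf_QE_wproj.
  exact: valid_QE_wproj.
have := tame_qf e k qg rg; case=> p p0 h; exists p => // x y xy nor.
by rewrite -!gP; exact: h.
Qed.

End Definable.

(** * Extreme values over a real closed field *)

Section Compactness.
Variable R : rcfType.
Implicit Types (e : seq R) (P : seq R -> Prop) (t : seq R -> R).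

Lemma nth_set e i k v : (set_nth 0 e k v)`_i = if i == k then v else e`_i.
Proof. exact: nth_set_nth. Qed.

Definition dterm t := exists T : GRing.term R, forall e, GRing.eval e T = t e.

Lemma dterm_nth i : dterm (fun e => e`_i).
Proof. by exists (GRing.Var _ i). Qed.

Lemma dterm_cst c : dterm (fun=> c).
Proof. by exists (GRing.Const c). Qed.

Lemma dtermD t u : dterm t -> dterm u -> dterm (fun e => t e + u e).
Proof. by move=> [T TP] [V VP]; exists (GRing.Add T V) => e /=; rewrite TP VP. Qed.

Lemma dtermN t : dterm t -> dterm (fun e => - t e).
Proof. by move=> [T TP]; exists (GRing.Opp T) => e /=; rewrite TP. Qed.

Lemma dtermM t u : dterm t -> dterm u -> dterm (fun e => t e * u e).
Proof. by move=> [T TP] [V VP]; exists (GRing.Mul T V) => e /=; rewrite TP VP. Qed.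

Lemma definable_lt t u : dterm t -> dterm u -> definable (fun e => t e < u e).
Proof. by move=> [T TP] [V VP]; exists (ord.Lt T V) => e /=; rewrite TP VP. Qed.

Lemma definable_eq t u : dterm t -> dterm u -> definable (fun e => t e = u e).
Proof. by move=> [T TP] [V VP]; exists (ord.Equal T V) => e /=; rewrite TP VP. Qed.

Lemma definable_and P Q : definable P -> definable Q ->
  definable (fun e => P e /\ Q e).
Proof. by move=> [f fP] [g gQ]; exists (ord.And f g) => e /=; rewrite fP gQ. Qed.

Lemma definable_not P : definable P -> definable (fun e => ~ P e).
Proof. by move=> [f fP]; exists (ord.Not f) => e /=; rewrite fP. Qed.

Lemma definable_ex i P : definable P ->
  definable (fun e => exists v, P (set_nth 0 e i v)).
Proof.
move=> [f fP]; exists (ord.Exists i f) => e /=.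
by split=> -[v Pv]; exists v; apply/fP.
Qed.

Lemma eq_definable P Q : (forall e, P e <-> Q e) -> definable P -> definable Q.
Proof. by move=> PQ [f fP]; exists f => e; rewrite fP. Qed.

Lemma definable_ext P e e' : definable P -> (forall i, e`_i = e'`_i) ->
  P e -> P e'.
Proof. by move=> [f fP] ee' /fP h; apply/fP; apply: ord.eq_holds h. Qed.

(** A block of existential quantifiers. Environments are compared entry by entry, with default 0, so
    that their lengths do not matter. *)
Definition exs (s : seq nat) P e :=
  exists e', (forall i, i \notin s -> e'`_i = e`_i) /\ P e'.

Lemma definable_exs s P : definable P -> definable (exs s P).
Proof.
move=> dP; elim: s => [|i s IHs].
  apply: eq_definable (dP) => e; split=> [Pe|[e' [ee' Pe']]]; first by exists e.
  by apply: (definable_ext dP) Pe' => // i; apply: ee'.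
apply: eq_definable (definable_ex i IHs) => e; split.
  move=> [v [e' [ee' Pe']]]; exists e'; split=> // j.
  rewrite inE negb_or => /andP[ji js].
  by rewrite ee' // nth_set (negPf ji).
move=> [e' [ee' Pe']]; exists e'`_i, e'; split=> // j js.
rewrite nth_set; case: eqP => [->//|/eqP ji].
by apply: ee'; rewrite inE negb_or ji.
Qed.

(* Coordinate 0 is the parameter d of a decreasing family of sets, coordinates
   1 to n are those of its points.  The last coordinate of the cluster point is
   the supremum of the numbers that some member of the family stays above. *)
Lemma definable_cluster (n : nat) (B : R) P : definable P ->
  (forall e e', (forall i, (i <= n)%N -> e`_i = e'`_i) -> P e -> P e') ->
  (forall e d, P e -> e`_0 <= d -> P (set_nth 0 e 0 d)) ->
  (forall d, 0 < d -> exists e, e`_0 = d /\ P e) ->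
  (forall e i, P e -> (0 < i <= n)%N -> `|e`_i| <= B) ->
  exists a : seq R, forall d, 0 < d -> exists e,
    [/\ e`_0 = d, P e & forall i, (0 < i <= n)%N -> `|e`_i - a`_i| < d].
Proof.
elim: n P => [|n IHn] P dP supp mono nonempty bdd.
  exists [::] => d /nonempty[e [e0 Pe]]; exists e; split=> // i.
  by rewrite leqn0 => /andP[] /[swap] /eqP->.
pose k := n.+1.
(* Coordinate [k.+1] stores a candidate bound u. [Q] says that for some v > 0 every point of the
   member with parameter v has k-th coordinate at least u. *)
pose Q e := exists v, ~ (~ (0 < (set_nth 0 e 0 v)`_0)) /\
  ~ exs (iota 1 k) (fun e' => P e' /\ e'`_k < e'`_k.+1) (set_nth 0 e 0 v).
have dQ : definable Q.
  apply: (@definable_ex 0 (fun e => ~ (~ (0 < e`_0)) /\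
    ~ exs (iota 1 k) (fun e' => P e' /\ e'`_k < e'`_k.+1) e)).
  apply: definable_and.
    by do 2 apply: definable_not; apply: definable_lt (dterm_cst 0) (dterm_nth 0).
  apply/definable_not/definable_exs/definable_and => //.
  exact: definable_lt (dterm_nth k) (dterm_nth k.+1).
pose T u := Q (set_nth 0 [::] k.+1 u).
have TP u : T u <-> exists2 v, 0 < v & forall e, e`_0 = v -> P e -> u <= e`_k.
  split.
    move=> [v [v0 hv]]; exists v.
      by move: v0; rewrite nth_set => /NNPP.
    move=> e e0 Pe; rewrite leNgt; apply/negP => lt; apply: hv.
    (* Cutting [e] after coordinate k gives the entries outside 1..k the default value 0 that [exs]
       demands there; [supp] carries [P] over to the cut sequence. *)
    exists (set_nth 0 (mkseq (nth 0 e) k.+1) k.+1 u); split=> [i|].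
      rewrite mem_iota !nth_set nth_nil add1n => ik.
      case: eqP => [->//|/eqP ik1]; case: (posnP i) => [->|i0].
        by rewrite nth_mkseq.
      rewrite nth_default // size_mkseq.
      by move: ik ik1; rewrite /k; lia.
    split; first by apply: supp Pe => i ik; rewrite nth_set ltn_eqF // nth_mkseq.
    by rewrite !nth_set eqxx ltn_eqF // nth_mkseq.
  move=> [v v0 hv]; exists v; split; first by rewrite nth_set; apply.
  move=> [e [ee [Pe lt]]].
  have e0 : e`_0 = v by rewrite (ee 0%N) ?nth_set ?mem_iota.
  have := hv e e0 Pe; rewrite leNgt => /negP; apply; move: lt.
  rewrite [X in _ < X]ee; last by rewrite mem_iota add1n ltnn andbF.
  by rewrite !nth_set eqxx.
have kk : (0 < k <= k)%N by rewrite leqnn.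
have [ak [akub aklub]] : exists s, is_lub T s.
  apply: tame_lub; first exact: definable_tame.
    exists (- B); apply/TP; exists 1; rewrite ?ltr01 // => e _ Pe.
    by have := bdd e k Pe kk; rewrite ler_norml => /andP[].
  exists B => u /TP[v v0 hv]; have [e [e0 Pe]] := nonempty v v0.
  by apply: le_trans (hv e e0 Pe) _; have := bdd e k Pe kk; rewrite ler_norml => /andP[].
(* The last coordinate is confined to within the parameter of [ak] and then quantified away, which
   leaves a decreasing family in dimension n. *)
pose P' := exs [:: k] (fun e => (e`_k - ak < e`_0 /\ ak - e`_k < e`_0) /\ P e).
have nek i : (i <= n)%N -> (i == k) = false by rewrite -ltnS => /ltn_eqF.
have [|||||a' a'P] := IHn P'.
- apply/definable_exs/definable_and => //.
  have dk := dterm_nth k; have d0 := dterm_nth 0; have da := dterm_cst ak.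
  by apply: definable_and; apply: definable_lt => //; apply: dtermD => //;
    apply: dtermN.
- move=> e e' ee' [e1 [ee1 [lt Pe1]]].
  have e1E i : (i <= n.+1)%N -> e1`_i = (set_nth 0 e' k e1`_k)`_i.
    rewrite nth_set leq_eqVlt -/k; case: eqP => [->//|/eqP ik /= ilt].
    by rewrite ee1 ?inE // ee'.
  exists (set_nth 0 e' k e1`_k); split=> [i|].
    by rewrite inE nth_set => /negPf->.
  by split; [rewrite -!e1E | apply: supp Pe1].
- move=> e d [e1 [ee1 [lt Pe1]]] e0d.
  have e10 : e1`_0 = e`_0 by apply: ee1.
  exists (set_nth 0 e1 0 d); split=> [i ik|].
    by rewrite !nth_set ee1.
  split; last by apply: mono => //; rewrite e10.
  rewrite !nth_set; move: lt; rewrite e10 => -[l1 l2].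
  by split; apply: lt_le_trans e0d.
- move=> d d0.
  have [u [/TP[v v0 uv] du]] : exists u, T u /\ ak - d < u.
    apply: NNPP => nou; suff : ak <= ak - d by lra.
    by apply: aklub => u Tu; rewrite leNgt; apply/negP => h; apply: nou; exists u.
  (* Otherwise [ak + d / 2] would belong to [T] and exceed its supremum. With parameter min v d,
     monotonicity puts the point in the member v, which bounds its k-th coordinate below by u, and
     in the member d, which is the one required. *)
  have [e [e0 Pe ek]] : exists e, [/\ e`_0 = Num.min v d, P e & e`_k < ak + d / 2].
    apply: NNPP => noe; suff /akub : T (ak + d / 2) by lra.
    apply/TP; exists (Num.min v d); first by rewrite lt_min v0.
    by move=> e e0 Pe; rewrite leNgt; apply/negP => h; apply: noe; exists e.
  have Pv : P (set_nth 0 e 0 v) by apply: mono; rewrite // e0 ge_min lexx.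
  have Pd : P (set_nth 0 e 0 d) by apply: mono; rewrite // e0 ge_min lexx orbT.
  have k0 : (k == 0%N) = false by [].
  have := uv _ _ Pv; rewrite !nth_set k0 => /(_ erefl) uk.
  exists (set_nth 0 e 0 d); split; first by rewrite nth_set.
  exists (set_nth 0 e 0 d); split=> //; split=> //.
  by rewrite !nth_set k0 eqxx; split; lra.
- move=> e i [e1 [ee1 [lt Pe1]]] /andP[i0 ik].
  by rewrite -ee1 ?inE ?nek //; apply: bdd => //; rewrite i0 leqW.
exists (set_nth 0 a' k ak) => d /a'P[e [e0 [e1 [ee1 [lt Pe1]]] ea]].
exists e1; split=> //; first by rewrite ee1.
move=> i /andP[i0]; rewrite leq_eqVlt nth_set; case: eqP => [->|/eqP ik /= ilt].
  by move: lt; rewrite (ee1 0%N) // e0 => lt _; rewrite ltr_norml; lra.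
by rewrite ee1 ?inE //; apply: ea; rewrite i0.
Qed.

(* Continuity in coordinates 1 to n only, hence also independence of the others. *)
Definition continuous_in n t := forall (a : seq R) eta, 0 < eta ->
  exists2 d, 0 < d & forall e, (forall i, (0 < i <= n)%N -> `|e`_i - a`_i| < d) ->
    `|t e - t a| < eta.

Definition cterm n t := dterm t /\ continuous_in n t.

Lemma cterm_nth n i : (0 < i <= n)%N -> cterm n (fun e => e`_i).
Proof.
by move=> i0; split; [exact: dterm_nth | move=> a eta h; exists eta => // e; apply].
Qed.

Lemma cterm_cst n c : cterm n (fun=> c).
Proof.
split; first exact: dterm_cst.
by move=> a eta h; exists 1 => // e _; rewrite subrr normr0.
Qed.

Lemma ctermD n t u : cterm n t -> cterm n u -> cterm n (fun e => t e + u e).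
Proof.
move=> [dt ct] [du cu]; split; first exact: dtermD.
move=> a eta eta0.
have [|d d0 td] := ct a (eta / 2); first by lra.
have [|c c0 uc] := cu a (eta / 2); first by lra.
exists (Num.min d c) => [|e h]; first by rewrite lt_min d0.
have : `|t e - t a| < eta / 2 by apply: td => i /h; rewrite lt_min => /andP[].
have : `|u e - u a| < eta / 2 by apply: uc => i /h; rewrite lt_min => /andP[].
rewrite !ltr_norml => /andP[? ?] /andP[? ?].
by lra.
Qed.

Lemma ctermN n t : cterm n t -> cterm n (fun e => - t e).
Proof.
move=> [dt ct]; split; first exact: dtermN.
move=> a eta /(ct a)[d d0 td]; exists d => // e /td.
by rewrite -opprD normrN.
Qed.

Lemma ctermM n t u : cterm n t -> cterm n u -> cterm n (fun e => t e * u e).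
Proof.
move=> [dt ct] [du cu]; split; first exact: dtermM.
move=> a eta eta0.
pose M := `|t a| + `|u a| + 1.
have M0 : 1 <= M by rewrite /M lerDr addr_ge0.
(* If both increments are below r <= 1, the three terms of the expanded difference add up to at most
   r * M <= eta / 2. *)
pose r := Num.min 1 (eta / (M * 2)).
have Mi : 0 < M * 2 by lra.
have r0 : 0 < r by rewrite lt_min ltr01 divr_gt0.
have [d d0 td] := ct a r r0.
have [c c0 uc] := cu a r r0.
exists (Num.min d c) => [|e h]; first by rewrite lt_min d0.
have {td} td : `|t e - t a| < r by apply: td => i /h; rewrite lt_min => /andP[].
have {uc} uc : `|u e - u a| < r by apply: uc => i /h; rewrite lt_min => /andP[].
have r1 : r <= 1 by rewrite ge_min lexx.
have r2 : r * (M * 2) <= eta by rewrite -ler_pdivlMr // ge_min lexx orbT.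
have -> : t e * u e - t a * u a =
  (t e - t a) * (u e - u a) + (t e - t a) * u a + t a * (u e - u a) by ring.
apply: le_lt_trans (ler_normD _ _) _.
apply: le_lt_trans (lerD (ler_normD _ _) (lexx _)) _.
rewrite !normrM.
have := normr_ge0 (t a); have := normr_ge0 (u a).
have := normr_ge0 (t e - t a); have := normr_ge0 (u e - u a).
move: td uc r2; rewrite /M.
move: `|t e - t a| `|u e - u a| `|t a| `|u a| => x y p q.
by move=> xr yr hr y0 x0 q0 p0; nra.
Qed.

Lemma continuous_in_supp n t e e' : continuous_in n t ->
  (forall i, (0 < i <= n)%N -> e`_i = e'`_i) -> t e = t e'.
Proof.
move=> ct ee'; apply/eqP; rewrite -subr_eq0 -normr_eq0 eq_le normr_ge0 andbT.
rewrite leNgt; apply/negP => /(ct e')[d d0 /(_ e)].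
rewrite ltxx => h; have // : false.
by apply: h => i /ee'->; rewrite subrr normr0.
Qed.

(** The set of values is definable and bounded, hence has a supremum [mu]. The near-maximizers, with
    t > mu - d on h = 0, form a decreasing family; by continuity its cluster point satisfies the
    constraint and attains [mu]. *)
Lemma cterm_max n (B M : R) t h e0 : cterm n t -> cterm n h -> h e0 = 0 ->
  (forall e i, h e = 0 -> (0 < i <= n)%N -> `|e`_i| <= B) ->
  (forall e, h e = 0 -> t e <= M) ->
  exists2 a, h a = 0 & forall e, h e = 0 -> t e <= t a.
Proof.
move=> [dt ct] [dh ch] h0 hB tM.
pose U u := exists2 e, h e = 0 & t e = u.
have [mu [muub mulub]] : exists s, is_lub U s.
  apply: tame_lub; last 1 first.
  - by exists M => u [e he <-]; apply: tM.
  - pose k := n.+1.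
    pose Q := exs (iota 1 n) (fun e => h e = 0 /\ t e = e`_k).
    have dQ : definable Q.
      apply/definable_exs/definable_and; apply: definable_eq => //.
        exact: dterm_cst.
      exact: dterm_nth.
    have QU u : Q (set_nth 0 [::] k u) <-> U u.
      split=> [[e [ee [he te]]]|[e he te]].
        exists e => //; rewrite te (ee k) ?nth_set ?eqxx //.
        by rewrite mem_iota add1n ltnn andbF.
      (* [exs] prescribes all coordinates outside 1..n: coordinate 0 is reset, those beyond n are
         dropped, and u is stored at [k]. Neither [h] nor [t] sees the change. *)
      pose e' := set_nth 0 (set_nth 0 (take k e) 0 0) k u.
      have e'E i : (0 < i <= n)%N -> e`_i = e'`_i.
        move=> /andP[i0 ik]; rewrite !nth_set ltn_eqF //.
        by rewrite gtn_eqF // nth_take.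
      exists e'; split=> [i|].
        rewrite mem_iota add1n !nth_set nth_nil => ik.
        case: eqP => // /eqP ik1; case: (posnP i) => // i0.
        rewrite nth_default // size_take_min (leq_trans (geq_minl _ _)) //.
        by move: ik ik1; rewrite /k; lia.
      rewrite -(continuous_in_supp ch e'E) -(continuous_in_supp ct e'E).
      by rewrite nth_set eqxx.
    have [p p0 pP] := definable_tame [::] k dQ.
    by exists p => // x y xy nor; rewrite -!QU; apply: pP.
  - by exists (t e0), e0.
pose P e := h e = 0 /\ mu - e`_0 < t e.
have [|||||a aP] := @definable_cluster n B P.
- apply: definable_and; first exact: definable_eq (dterm_cst 0).
  apply: definable_lt => //; apply: dtermD; first exact: dterm_cst.
  by apply/dtermN/dterm_nth.
- move=> e e' ee' [he te].
  have ee1 i : (0 < i <= n)%N -> e`_i = e'`_i by move=> /andP[_ /ee'].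
  split; first by rewrite -(continuous_in_supp ch ee1).
  by rewrite -(continuous_in_supp ct ee1) -ee'.
- move=> e d [he te] ed.
  have ee1 i : (0 < i <= n)%N -> e`_i = (set_nth 0 e 0 d)`_i.
    by rewrite nth_set; case: i.
  split; first by rewrite -(continuous_in_supp ch ee1).
  by rewrite -(continuous_in_supp ct ee1) nth_set eqxx; lra.
- move=> d d0.
  have [e [he te]] : exists e, h e = 0 /\ mu - d < t e.
    apply: NNPP => noe; suff : mu <= mu - d by lra.
    apply: mulub => u [e he <-]; rewrite leNgt; apply/negP => lt.
    by apply: noe; exists e.
  have ee1 i : (0 < i <= n)%N -> e`_i = (set_nth 0 e 0 d)`_i.
    by rewrite nth_set; case: i.
  exists (set_nth 0 e 0 d); split; first by rewrite nth_set.
  split; first by rewrite -(continuous_in_supp ch ee1).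
  by rewrite -(continuous_in_supp ct ee1) nth_set.
- by move=> e i [he _]; apply: hB.
exists a.
  apply/eqP; rewrite -normr_eq0 eq_le normr_ge0 andbT leNgt; apply/negP => ha.
  have [d d0 hd] := ch a _ ha; have [e [e0d [he _] ea]] := aP d d0.
  by have := hd e ea; rewrite he sub0r normrN ltxx.
move=> e he; apply: le_trans (_ : mu <= _); first by apply: muub; exists e.
rewrite leNgt; apply/negP => lt.
have gap : 0 < (mu - t a) / 2 by lra.
have [d d0 td] := ct a _ gap.
have d1 : 0 < Num.min d ((mu - t a) / 2) by rewrite lt_min d0.
have [e1 [e10 [he1 te1] e1a]] := aP _ d1.
have : `|t e1 - t a| < (mu - t a) / 2.
  by apply: td => i /e1a; rewrite lt_min => /andP[].
rewrite ltr_norml => /andP[l1 l2].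
have : Num.min d ((mu - t a) / 2) <= (mu - t a) / 2 by rewrite ge_min lexx orbT.
by move: te1; rewrite e10; lra.
Qed.
End Compactness.

(** * Existence of the maximal overlap *)

Section MaxOverlap.
Variable C : numClosedFieldType.
Notation R := (realsub C).
Implicit Types f : seq R -> C.

Lemma reD (x y : C) : re (x + y) = re x + re y.
Proof. by apply: val_inj; rewrite /= raddfD. Qed.
Lemma imD (x y : C) : im (x + y) = im x + im y.
Proof. by apply: val_inj; rewrite /= raddfD. Qed.
Lemma re_conj (x : C) : re x^* = re x.
Proof. by apply: val_inj; rewrite /= Re_conj. Qed.
Lemma im_conj (x : C) : im x^* = - im x.
Proof. by apply: val_inj; rewrite /= Im_conj. Qed.

Lemma re_rect (x y : R) : re (val x + 'i * val y) = x.
Proof. by apply: val_inj; rewrite /= Re_rect ?rvalP. Qed.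
Lemma im_rect (x y : R) : im (val x + 'i * val y) = y.
Proof. by apply: val_inj; rewrite /= Im_rect ?rvalP. Qed.

Lemma mul_rect (x y : C) : x * y =
  val (re x * re y - im x * im y) + 'i * val (re x * im y + im x * re y).
Proof.
rewrite {1}(re_im x) {1}(re_im y) /=.
move: ('Re x) ('Im x) ('Re y) ('Im y) => a b c d.
apply/eqP; rewrite -subr_eq0; set u := (X in X == 0).
have -> : u = ('i ^+ 2 + 1) * (b * d) by rewrite /u; ring.
by rewrite sqrCi addNr mul0r.
Qed.

Lemma reM (x y : C) : re (x * y) = re x * re y - im x * im y.
Proof. by rewrite mul_rect re_rect. Qed.
Lemma imM (x y : C) : im (x * y) = re x * im y + im x * re y.
Proof. by rewrite mul_rect im_rect. Qed.

Definition normsq (z : C) : R := re z ^+ 2 + im z ^+ 2.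

Lemma val_normsq z : val (normsq z) = `|z| ^+ 2.
Proof. by rewrite normC2_Re_Im. Qed.

Definition complex_cterm n f :=
  cterm n (fun e => re (f e)) /\ cterm n (fun e => im (f e)).

Lemma eq_cterm n (t u : seq R -> R) : t =1 u -> cterm n t -> cterm n u.
Proof.
move=> tu [[T TP] ct]; split; first by exists T => e; rewrite TP tu.
by move=> a eta /(ct a)[d d0 h]; exists d => // e /h; rewrite !tu.
Qed.

Lemma complex_cterm_cst n c : complex_cterm n (fun=> c).
Proof. by split; apply: cterm_cst. Qed.

Lemma complex_ctermD n f g : complex_cterm n f -> complex_cterm n g ->
  complex_cterm n (fun e => f e + g e).
Proof.
move=> [f1 f2] [g1 g2]; split.
  by apply: eq_cterm (ctermD f1 g1) => e; rewrite reD.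
by apply: eq_cterm (ctermD f2 g2) => e; rewrite imD.
Qed.

Lemma complex_ctermM n f g : complex_cterm n f -> complex_cterm n g ->
  complex_cterm n (fun e => f e * g e).
Proof.
move=> [f1 f2] [g1 g2]; split.
  by apply: eq_cterm (ctermD (ctermM f1 g1) (ctermN (ctermM f2 g2))) => e;
    rewrite reM.
by apply: eq_cterm (ctermD (ctermM f1 g2) (ctermM f2 g1)) => e; rewrite imM.
Qed.

Lemma complex_cterm_conj n f : complex_cterm n f ->
  complex_cterm n (fun e => (f e)^*).
Proof.
move=> [f1 f2]; split; first by apply: eq_cterm f1 => e; rewrite re_conj.
by apply: eq_cterm (ctermN f2) => e; rewrite im_conj.
Qed.

Lemma complex_cterm_sum n m (F : 'I_m -> seq R -> C) :
  (forall i, complex_cterm n (F i)) ->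
  complex_cterm n (fun e => \sum_(i < m) F i e).
Proof.
elim: m F => [|m IHm] F Fc.
  have [h1 h2] := complex_cterm_cst n 0.
  by split; [apply: eq_cterm h1 | apply: eq_cterm h2] => e; rewrite big_ord0.
have [h1 h2] := complex_ctermD (IHm _ (fun i => Fc (widen_ord (leqnSn m) i))) (Fc ord_max).
by split; [apply: eq_cterm h1 | apply: eq_cterm h2] => e; rewrite big_ord_recr.
Qed.

Lemma cterm_normsq n f : complex_cterm n f -> cterm n (fun e => normsq (f e)).
Proof. by move=> [f1 f2]; apply: ctermD; apply: ctermM. Qed.

(** Qubit j occupies the real coordinates 4j+1 to 4j+4; coordinate 0 stays free for the parameter of
    [definable_cluster]. *)
Definition qubit (j : nat) (e : seq R) : 'cV[C]_2 :=
  \col_(k < 2) (val e`_(4 * j + 2 * k + 1) + 'i * val e`_(4 * j + 2 * k + 2)).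

Lemma complex_cterm_qubit j k : (j < 3)%N ->
  complex_cterm 12 (fun e => qubit j e k 0).
Proof.
move=> j3; split.
  apply: eq_cterm (@cterm_nth R 12 (4 * j + 2 * k + 1) _) => [e|].
    by rewrite mxE re_rect.
  by have := ltn_ord k; lia.
apply: eq_cterm (@cterm_nth R 12 (4 * j + 2 * k + 2) _) => [e|].
  by rewrite mxE im_rect.
by have := ltn_ord k; lia.
Qed.

Lemma braket_normsq (v : 'cV[C]_2) :
  braket v v = val (normsq (v 0 0) + normsq (v 1 0)).
Proof.
have -> : val (normsq (v 0 0) + normsq (v 1 0)) = `|v 0 0| ^+ 2 + `|v 1 0| ^+ 2.
  by rewrite -!val_normsq.
by rewrite /braket !big_ord_recl big_ord0 addr0 !normCKC; congr (_ + (v _ 0)^* * v _ 0);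
  apply: val_inj.
Qed.

Lemma normalizedP (v : 'cV[C]_2) :
  normalized v <-> normsq (v 0 0) + normsq (v 1 0) = 1.
Proof.
rewrite /normalized braket_normsq.
by split=> [h|->//]; apply: val_inj.
Qed.

Lemma normalized_le1 (v : 'cV[C]_2) i : normalized v -> `|v i 0| <= 1.
Proof.
rewrite /normalized /braket => h.
rewrite -(@expr_le1 _ 2) // normCKC -h (bigD1 i) //= lerDl.
by apply: sumr_ge0 => k _; rewrite -normCKC exprn_ge0.
Qed.

Lemma IsG_exists (psi : 'cV[C]_8) : exists g, IsG psi g.
Proof.
pose amp e := braket (prod3 (qubit 0 e) (qubit 1 e) (qubit 2 e)) psi.
pose t e := normsq (amp e).
pose h1 j e := normsq (qubit j e 0 0) + normsq (qubit j e 1 0) - 1.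
(* A sum of squares merges the three normalization conditions into the single equation that
   [cterm_max] takes. *)
pose h e := h1 0%N e ^+ 2 + h1 1%N e ^+ 2 + h1 2%N e ^+ 2.
have hP e : h e = 0 <-> forall j, (j < 3)%N -> normalized (qubit j e).
  have hj j : normalized (qubit j e) <-> h1 j e = 0.
    rewrite normalizedP /h1; split=> [->|/eqP]; first by rewrite subrr.
    by rewrite subr_eq0 => /eqP.
  split=> [he|nj].
    have := sqr_ge0 (h1 0%N e); have := sqr_ge0 (h1 1%N e); have := sqr_ge0 (h1 2%N e).
    move: he; rewrite /h => he p2 p1 p0.
    move=> [|[|[|//]]] _; rewrite hj; apply/eqP; rewrite -sqrf_eq0; apply/eqP; lra.
  have [n0 n1 n2] := And3 (nj 0%N isT) (nj 1%N isT) (nj 2%N isT).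
  move/hj: n0; move/hj: n1; move/hj: n2.
  by rewrite /h => -> -> ->; rewrite expr0n !addr0.
have tc : cterm 12 t.
  apply: cterm_normsq; apply: complex_cterm_sum => i.
  refine (complex_ctermM (complex_cterm_conj _) (complex_cterm_cst _ _)).
  have [c1 c2] := complex_ctermM (complex_ctermM
    (@complex_cterm_qubit 0 (q1 i) isT) (@complex_cterm_qubit 1 (q2 i) isT))
    (@complex_cterm_qubit 2 (q3 i) isT).
  by split; [apply: eq_cterm c1 | apply: eq_cterm c2] => e; rewrite [in RHS]mxE.
have h1c j : (j < 3)%N -> cterm 12 (h1 j).
  move=> j3; apply: ctermD; last exact: cterm_cst.
  by apply: ctermD; apply/cterm_normsq/complex_cterm_qubit.
have hc : cterm 12 h.
  by apply: ctermD; [apply: ctermD|]; apply: ctermM; apply: h1c.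
have encode (a1 a2 a3 : 'cV[C]_2) : exists e,
    [/\ qubit 0 e = a1, qubit 1 e = a2 & qubit 2 e = a3].
  exists [:: 0; re (a1 0 0); im (a1 0 0); re (a1 1 0); im (a1 1 0);
    re (a2 0 0); im (a2 0 0); re (a2 1 0); im (a2 1 0);
    re (a3 0 0); im (a3 0 0); re (a3 1 0); im (a3 1 0)].
  split; apply/colP=> -[[|[|//]] i2]; rewrite mxE /= -Crect;
    by congr (_ _ _); apply: val_inj.
have h1E j e : h1 j e = e`_(4 * j + 1) ^+ 2 + e`_(4 * j + 2) ^+ 2 +
    (e`_(4 * j + 3) ^+ 2 + e`_(4 * j + 4) ^+ 2) - 1.
  by rewrite /h1 /normsq !mxE !re_rect !im_rect !addn0 /= muln1 -!addnA.
pose v0 : 'cV[C]_2 := \col_(k < 2) (k == 0)%:R.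
have nv0 : normalized v0.
  rewrite /normalized /braket !big_ord_recl big_ord0 !mxE /=.
  by rewrite conjC1 conjC0 mul0r mulr1 !addr0.
have [e0 [e01 e02 e03]] := encode v0 v0 v0.
(* This is the bound on [t]: every entry of a product of unit vectors has modulus at most 1. *)
have SR : (\sum_i `|psi i 0|) ^+ 2 \is Num.real.
  by apply/rpredX/rpred_sum => i _; exact: normr_real.
have [|||a ha ta] := @cterm_max R 12 1 (RealSub SR) t h e0 tc hc.
- by apply/hP => -[|[|[|//]]] _; rewrite ?e01 ?e02 ?e03.
- move=> e i /hP he i12.
  have [j [r [j3 r4 ->]]] : exists j r, [/\ (j < 3)%N, (r < 4)%N & i = (4 * j + r.+1)%N].
    exists (i.-1 %/ 4)%N, (i.-1 %% 4)%N; split; lia.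
  have := he j j3; rewrite normalizedP => /eqP; rewrite -subr_eq0 -/(h1 j e) h1E => /eqP.
  have := sqr_ge0 e`_(4 * j + 1); have := sqr_ge0 e`_(4 * j + 2).
  have := sqr_ge0 e`_(4 * j + 3); have := sqr_ge0 e`_(4 * j + 4).
  move=> s1 s2 s3 s4 s; rewrite -(@expr_le1 _ 2) // real_normK ?num_real //.
  by move: r r4 => [|[|[|[|//]]]] _; lra.
- move=> e /hP he; rewrite -[_ <= _]/(val (t e) <= (\sum_i `|psi i 0|) ^+ 2).
  rewrite val_normsq lerXn2r ?nnegrE ?sumr_ge0 //.
  apply: le_trans (ler_norm_sum _ _ _) _; apply: ler_sum => i _.
  rewrite normrM norm_conjC mxE !normrM ler_piMl // mulr_ile1 ?mulr_ge0 //.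
    by apply: mulr_ile1 => //; apply: normalized_le1; apply: he.
  by apply: normalized_le1; apply: he.
exists `|amp a|; split.
  exists (qubit 0 a), (qubit 1 a), (qubit 2 a).
  by move/hP: ha => ha; split=> //; apply: ha.
move=> a1 a2 a3 n1 n2 n3; have [e [e1 e2 e3]] := encode a1 a2 a3.
have /ta : h e = 0 by apply/hP => -[|[|[|//]]] _; rewrite ?e1 ?e2 ?e3.
rewrite -[_ <= _]/(val (t e) <= val (t a)) !val_normsq ler_sqr ?nnegrE //.
by rewrite /amp e1 e2 e3.
Qed.
End MaxOverlap.

(** * The lower bound for pure states *)

Lemma quadratic_ge0 (R : realFieldType) (a b c : R) :
  (forall x, 0 <= a * x ^+ 2 + 2 * b * x + c) -> 0 <= a /\ b ^+ 2 <= a * c.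
Proof.
move=> q; have c0 : 0 <= c by have := q 0; rewrite expr0n /= !mulr0 !add0r.
have a0 : 0 <= a.
  rewrite leNgt; apply/negP => a0; pose r := c / - a.
  have r0 : 0 <= r by rewrite divr_ge0 // oppr_ge0 ltW.
  have ar : a * r = - c by rewrite /r; field; rewrite ?oppr_eq0 lt_eqF.
  (* Adding the values at two opposite points cancels the linear term, and a < 0 would make what is
     left, a - c - c r, negative. *)
  have h1 := q (1 + r); have h2 := q (- (1 + r)).
  have : 0 <= a * (1 + r) ^+ 2 + c by lra.
  have -> : a * (1 + r) ^+ 2 = a + 2 * (a * r) + (a * r) * r by ring.
  have : 0 <= c * r by exact: mulr_ge0.
  by rewrite ar; lra.
split=> //; move: a0; rewrite le_eqVlt => /orP[/eqP a0|a0].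
  rewrite -a0 mul0r; have [->|b0] := eqVneq b 0; first by rewrite expr0n.
  have := q (- (c + 1) / (2 * b)); rewrite -a0 mul0r add0r.
  by rewrite mulrCA mulfV ?mulr1 ?mulf_neq0 ?pnatr_eq0 //; lra.
have := q (- b / a).
have -> : a * (- b / a) ^+ 2 + 2 * b * (- b / a) + c = (a * c - b ^+ 2) / a.
  by field; rewrite gt_eqF.
by rewrite pmulr_lge0 ?invr_gt0 // subr_ge0.
Qed.

(** The difference of the two sides is half the sum of the (x + y + z) (x - y)^2 over the three
    pairs plus three times the sum of the x (y - z)^2. *)
Lemma amgm3 (R : realFieldType) (x y z : R) : 0 <= x -> 0 <= y -> 0 <= z ->
  27 * (x * y * z) <= (x + y + z) ^+ 3.
Proof.
move=> x0 y0 z0.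
have := mulr_ge0 x0 (sqr_ge0 (y - z)); have := mulr_ge0 y0 (sqr_ge0 (x - z)).
have := mulr_ge0 z0 (sqr_ge0 (x - y)); have s0 := addr_ge0 (addr_ge0 x0 y0) z0.
have := mulr_ge0 s0 (sqr_ge0 (y - z)); have := mulr_ge0 s0 (sqr_ge0 (x - z)).
have := mulr_ge0 s0 (sqr_ge0 (x - y)).
by lra.
Qed.

(** Eliminating x and then y by discriminants, with K = D + u^2 = E + v^2, gives D h2^2 + E h1^2 <=
    D E. As D <= E, this yields h1^2 + h2^2 <= E, and s + E = 1 + 2 p <= 5/4. *)
Lemma canonical_form_real_bound (R : realFieldType) (b c d h1 h2 : R) :
  0 <= b -> 0 <= c -> 0 <= d ->
  let s := b ^+ 2 + c ^+ 2 + d ^+ 2 in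
  (forall x y : R, 0 <= (1 - s - 2 * (b * c * d)) * x ^+ 2
    + (1 - s + 2 * (b * c * d)) * y ^+ 2 - 2 * (b + c * d) * h1 * x
    + 2 * (b - c * d) * h2 * y
    + ((1 - c ^+ 2) * (1 - d ^+ 2) - h1 ^+ 2 - h2 ^+ 2)) ->
  s + h1 ^+ 2 + h2 ^+ 2 <= 5 / 4.
Proof.
move=> b0 c0 d0 s q.
pose p := b * c * d; pose D := 1 - s - 2 * p; pose E := 1 - s + 2 * p.
pose u := b + c * d; pose v := b - c * d; pose K := (1 - c ^+ 2) * (1 - d ^+ 2).
have p0 : 0 <= p by rewrite !mulr_ge0.
have KD : K = D + u ^+ 2 by rewrite /K /D /u /s /p; ring.
have KE : K = E + v ^+ 2 by rewrite /K /E /v /s /p; ring.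
have qx y : 0 <= D /\
    (- (u * h1)) ^+ 2 <= D * (E * y ^+ 2 + 2 * v * h2 * y + (K - h1 ^+ 2 - h2 ^+ 2)).
  apply: quadratic_ge0 => x; have := q x y.
  by rewrite -/p -/D -/E -/u -/v -/K; lra.
have D0 : 0 <= D by case: (qx 0).
(* If p > 1/8, then D >= 0 gives s <= 3/4, and AM-GM gives 27 p^2 <= s^3 <= 27/64, that is p <=
   1/8. *)
have p8 : p <= 1 / 8.
  rewrite leNgt; apply/negP => p8.
  have := amgm3 (sqr_ge0 b) (sqr_ge0 c) (sqr_ge0 d); rewrite -/s.
  have -> : b ^+ 2 * c ^+ 2 * d ^+ 2 = p ^+ 2 by rewrite /p; ring.
  have s34 : s <= 3 / 4 by move: D0; rewrite /D; lra.
  have s0 : 0 <= s by rewrite /s !addr_ge0 ?sqr_ge0.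
  have : s ^+ 3 <= (3 / 4) ^+ 3 by rewrite lerXn2r ?nnegrE //; lra.
  have : (1 / 8) ^+ 2 < p ^+ 2 by rewrite ltrXn2r ?nnegrE //; lra.
  lra.
suff : h1 ^+ 2 + h2 ^+ 2 <= E by rewrite /E; lra.
have DE : D <= E by rewrite /D /E; lra.
(* The final division by D fails at D = 0. There u h1 = 0: either u = 0, so K = 0 and both h1 and h2
   vanish, or h1 = 0 and the quadratic in y at x = 0 suffices. *)
have [Dz|Dn] := eqVneq D 0.
  have [|_ h] := @quadratic_ge0 _ E (v * h2) (K - h1 ^+ 2 - h2 ^+ 2).
    by move=> y; have := q 0 y; rewrite -/p -/D -/E -/u -/v -/K; lra.
  have [uz|un] := eqVneq u 0.
    have K0 : K = 0 by rewrite KD Dz uz expr0n addr0.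
    have := q 0 0; rewrite -/K K0; lra.
  have [_] := qx 0; rewrite Dz mul0r sqrrN => uh.
  have h10 : h1 = 0.
    apply/eqP; have : (u * h1) ^+ 2 == 0 by rewrite eq_le uh sqr_ge0.
    by rewrite sqrf_eq0 mulf_eq0 (negPf un).
  have Kp : 0 < K by rewrite KD Dz add0r lt0r sqr_ge0 expf_neq0.
  rewrite h10 expr0n add0r -(ler_pM2l Kp).
  move: h; rewrite exprMn h10 (_ : v ^+ 2 = K - E); [lra | rewrite KE; ring].
have Dp : 0 < D by rewrite lt0r Dn.
have [|_ h] := @quadratic_ge0 _ (D * E) (D * v * h2)
  (D * (K - h1 ^+ 2 - h2 ^+ 2) - (u * h1) ^+ 2).
  by move=> y; have [_] := qx y; rewrite sqrrN; lra.
have Kp : 0 < K by rewrite KD; have := sqr_ge0 u; lra.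
have key : D * K * (D * h2 ^+ 2 + E * h1 ^+ 2) <= D * K * (D * E).
  have v2 : v ^+ 2 = K - E by rewrite KE; ring.
  have u2 : u ^+ 2 = K - D by rewrite KD; ring.
  move: h; rewrite !exprMn v2 u2; lra.
have DK : 0 < D * K by exact: mulr_gt0.
move: key; rewrite (ler_pM2l DK) => key.
rewrite -(ler_pM2l Dp).
have : D * h1 ^+ 2 <= E * h1 ^+ 2 by rewrite ler_wpM2r ?sqr_ge0.
lra.
Qed.

(** * From the overlap bound to a quadratic inequality in one complex variable *)

Section CanonicalFormInequality.
Variable C : numClosedFieldType.
Implicit Types a b c d h x y z : C.

Lemma hermitian_ge0 (A B S : C) : 0 <= A -> 0 <= B ->
  (forall x y, x * y^* * S + x^* * y * S^* <= A * (x * x^*) + B * (y * y^*)) ->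
  S * S^* <= A * B.
Proof.
move=> A0 B0 H; have SS0 : 0 <= S * S^* by rewrite -normCK exprn_ge0.
have [Az|An] := eqVneq A 0.
  have Br : (B + 1)^* = B + 1 by rewrite geC0_conj // addr_ge0.
  (* For A = 0 this test vector gives (B + 2) |S|^2 <= 0. *)
  have := H (B + 1) S; rewrite Az !mul0r add0r Br -subr_ge0 => h.
  rewrite -oppr_ge0 -(pmulr_rge0 _ (_ : 0 < B + 2)); last by rewrite ltr_wpDl.
  by move: h; congr (_ <= _); ring.
have Ap : 0 < A by rewrite lt0r An.
have Ar : A^* = A by rewrite geC0_conj.
(* The test vector that minimizes the form up to scaling; it gives A (A B - |S|^2) >= 0. *)
have := H S^* A; rewrite conjCK Ar => h.
rewrite -subr_ge0 -(pmulr_rge0 _ Ap).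
move: h; rewrite -subr_ge0; congr (_ <= _); ring.
Qed.

(* The inequality says det ((|z|^2 + 1) I - M M^t* ) >= 0, where M is the 2x2
   matrix left by contracting the first index with (z^*, 1). *)
Lemma canonical_form_quadratic b c d h :
  (forall x0 x1 y0 y1 z0 z1,
    `|x0 * y0 * z0 + b * x0 * y1 * z1 + c * x1 * y0 * z1 + d * x1 * y1 * z0
      + h * x1 * y1 * z1| ^+ 2 <=
    (`|x0| ^+ 2 + `|x1| ^+ 2) * (`|y0| ^+ 2 + `|y1| ^+ 2) * (`|z0| ^+ 2 + `|z1| ^+ 2)) ->
  forall z, 0 <= (1 - (b * b^* + c * c^* + d * d^*)) * (z * z^*)
    - (b^* * c * d * z ^+ 2 + b * c^* * d^* * z^* ^+ 2)
    - ((b^* * h + h^* * c * d) * z + (b * h^* + h * c^* * d^*) * z^*)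
    + ((1 - c * c^*) * (1 - d * d^*) - h * h^*).
Proof.
move=> H z.
(* Contracting two indices leaves the vector (p, q). Taking its conjugate as the third qubit turns
   the left side of [H] into N^2, and one factor N cancels. *)
have row (y0 y1 : C) : `|y0 * z^* + y1 * d| ^+ 2 + `|y0 * c + y1 * (z^* * b + h)| ^+ 2
    <= (`|z| ^+ 2 + 1) * (`|y0| ^+ 2 + `|y1| ^+ 2).
  set p := y0 * z^* + _; set q := y0 * c + _.
  have := H z^* 1 y0 y1 p^* q^*.
  have -> : z^* * y0 * p^* + b * z^* * y1 * q^* + c * 1 * y0 * q^* + d * 1 * y1 * p^* +
    h * 1 * y1 * q^* = p * p^* + q * q^* by rewrite /p /q; ring.
  rewrite -!normCK !norm_conjC normr1 expr1n.
  set N := `|p| ^+ 2 + `|q| ^+ 2; have N0 : 0 <= N by rewrite addr_ge0 ?exprn_ge0.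
  rewrite ger0_norm // expr2; have [->|Nn] := eqVneq N 0.
    by move=> _; rewrite mulr_ge0 ?addr_ge0 ?exprn_ge0.
  by rewrite ler_pM2r // lt0r Nn.
(* [A] and [B] are the diagonal entries of (|z|^2 + 1) I - M M^t*, and [S] gives its off-diagonal
   entry up to sign and conjugation. *)
pose A := 1 - c * c^*; pose B := z * z^* + 1 - (d * d^* + (z^* * b + h) * (z * b^* + h^*)).
pose S := z^* * d^* + c * (z * b^* + h^*).
have conjw : (z^* * b + h)^* = z * b^* + h^* by rewrite rmorphD rmorphM /= conjCK.
have : S * S^* <= A * B.
  apply: hermitian_ge0.
  - have := row 1 0; rewrite !mul0r !addr0 !mul1r normr1 normr0 expr1n expr0n addr0 mulr1.
    by rewrite norm_conjC -subr_ge0 !normCK; congr (_ <= _); rewrite /A; ring.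
  - have := row 0 1; rewrite !mul0r !add0r !mul1r normr1 normr0 expr1n expr0n add0r mulr1.
    by rewrite -subr_ge0 !normCK conjw; congr (_ <= _); rewrite /B; ring.
  - move=> x y; have := row x y; rewrite !normCK -subr_ge0 => r.
    rewrite -subr_ge0; move: r; congr (_ <= _).
    by rewrite /A /B /S !(rmorphD, rmorphM) /= !conjCK; ring.
rewrite -subr_ge0; congr (_ <= _).
by rewrite /A /B /S !(rmorphD, rmorphM) /= !conjCK; ring.
Qed.
End CanonicalFormInequality.

Section CanonicalForm.
Variable C : numClosedFieldType.
Implicit Types a b c d h x y z : C.

Lemma unit_phase z : exists2 u : C, u * u^* = 1 & z = `|z| * u.
Proof.
have [->|z0] := eqVneq z 0; first by exists 1; rewrite ?normr0 ?mul0r // mul1r conjC1.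
exists (z / `|z|); last by rewrite mulrC divfK ?normr_eq0.
by rewrite -normCK normf_div normr_id divff ?normr_eq0 // expr1n.
Qed.

(* Substituting w z for z, with w a unit square root of the phase of
   b (c d)^* , makes the coefficient of z^2 real and nonnegative. *)
Lemma canonical_form_bound b c d h :
  (forall x0 x1 y0 y1 z0 z1,
    `|x0 * y0 * z0 + b * x0 * y1 * z1 + c * x1 * y0 * z1 + d * x1 * y1 * z0
      + h * x1 * y1 * z1| ^+ 2 <=
    (`|x0| ^+ 2 + `|x1| ^+ 2) * (`|y0| ^+ 2 + `|y1| ^+ 2) * (`|z0| ^+ 2 + `|z1| ^+ 2)) ->
  `|b| ^+ 2 + `|c| ^+ 2 + `|d| ^+ 2 + `|h| ^+ 2 <= 5 / 4.
Proof.
move=> /canonical_form_quadratic q.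
have [ub ub1 bE] := unit_phase b; have [uc uc1 cE] := unit_phase c.
have [ud ud1 dE] := unit_phase d.
have [br cr dr] : [/\ `|b|^* = `|b|, `|c|^* = `|c| & `|d|^* = `|d|].
  by rewrite !geC0_conj.
pose w := sqrtC (ub * uc^* * ud^*).
have w2 : w ^+ 2 = ub * uc^* * ud^* by rewrite sqrtCK.
have ww : w * w^* = 1.
  have n1 (u : C) : u * u^* = 1 -> `|u| = 1.
    by rewrite -normCK => /eqP; rewrite pexpr_eq1 // => /eqP.
  by rewrite -normCK -normrX w2 !normrM !norm_conjC !n1 // !mulr1.
(* This makes both halves of the linear coefficient depend on h only through the rotated [g] below
   and its conjugate, with real factors |b| and |c| |d|. *)
have cdw : uc * ud * w = ub * w^*.
  have -> : uc * ud * w = uc * ud * w ^+ 2 * w^*.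
    by rewrite expr2 -!mulrA ww mulr1.
  rewrite w2 (_ : _ * _ = (uc * uc^*) * (ud * ud^*) * (ub * w^*)); last by ring.
  by rewrite uc1 ud1 !mul1r.
have bcdw : ub^* * uc * ud * w ^+ 2 = 1.
  rewrite w2 (_ : _ * _ = (ub * ub^*) * (uc * uc^*) * (ud * ud^*)); last by ring.
  by rewrite ub1 uc1 ud1 !mul1r.
pose g := ub^* * w * h.
have gg : g * g^* = h * h^*.
  rewrite /g !rmorphM /= conjCK (_ : _ * _ = (ub * ub^*) * (w * w^*) * (h * h^*)); last by ring.
  by rewrite ub1 ww !mul1r.
have gc : g^* = ub * w^* * h^* by rewrite /g !rmorphM /= conjCK.
have key (z : C) : 0 <= (1 - (`|b| ^+ 2 + `|c| ^+ 2 + `|d| ^+ 2)) * (z * z^*)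
    - `|b| * `|c| * `|d| * (z ^+ 2 + z^* ^+ 2)
    - ((`|b| * g + `|c| * `|d| * g^*) * z + (`|b| * g^* + `|c| * `|d| * g) * z^*)
    + ((1 - `|c| ^+ 2) * (1 - `|d| ^+ 2) - g * g^*).
  have [W WE] : exists W, W = w * z by exists (w * z).
  have e1 : b^* * c * d * W ^+ 2 = `|b| * `|c| * `|d| * z ^+ 2.
    rewrite WE {1}bE {1}cE {1}dE rmorphM /= br.
    rewrite (_ : _ * _ = (ub^* * uc * ud * w ^+ 2) * (`|b| * `|c| * `|d| * z ^+ 2));
      last by ring.
    by rewrite bcdw mul1r.
  have e2 : (b^* * h + h^* * c * d) * W = (`|b| * g + `|c| * `|d| * g^*) * z.
    by rewrite WE gc -cdw /g {1}bE {1}cE {1}dE rmorphM /= br; ring.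
  have e1c : b * c^* * d^* * W^* ^+ 2 = `|b| * `|c| * `|d| * z^* ^+ 2.
    by have := congr1 Num.conj e1; rewrite !(rmorphXn, rmorphM) /= !conjCK br cr dr.
  have e2c : (b * h^* + h * c^* * d^*) * W^* =
      (`|b| * g^* + `|c| * `|d| * g) * z^*.
    have := congr1 Num.conj e2.
    by rewrite !(rmorphM, rmorphD) /= !conjCK br cr dr.
  have e3 : W * W^* = z * z^*.
    rewrite WE rmorphM /= (_ : _ * _ = (w * w^*) * (z * z^*)); last by ring.
    by rewrite ww mul1r.
  have := q W; rewrite e1 e1c e2 e2c e3 gg -!normCK -mulrDr; exact.
clearbody g.
have gRI : g * g^* = 'Re g ^+ 2 + 'Im g ^+ 2 by rewrite -normCK normC2_Re_Im.
have v54 : rval (5 / 4 : realsub C) = 5 / 4 by rewrite fmorph_div !rmorph_nat.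
rewrite [X in _ + X]normCK -gg gRI addrA -v54.
apply: (@canonical_form_real_bound (realsub C) (RealSub (normr_real b))
  (RealSub (normr_real c)) (RealSub (normr_real d)) (re g) (im g)).
- exact: normr_ge0.
- exact: normr_ge0.
- exact: normr_ge0.
move=> x y.
have conj_rect (r t : realsub C) : (rval r + 'i * rval t)^* = rval r - 'i * rval t.
  by rewrite rmorphD rmorphM /= conjCi (conj_Creal (rvalP r)) (conj_Creal (rvalP t)) mulNr.
have gE : g = rval (re g) + 'i * rval (im g) by exact: Crect.
have gcE : g^* = rval (re g) - 'i * rval (im g) by rewrite {1}gE conj_rect.
have {key} := key (rval x + 'i * rval y).
have {}gRI : g * g^* = rval (re g) ^+ 2 + rval (im g) ^+ 2 by [].
move: (re g) (im g) gE gcE gRI => k l gE gcE gRI.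
rewrite gRI conj_rect gcE gE.
have bE' : `|b| = rval (RealSub (normr_real b)) by [].
have cE' : `|c| = rval (RealSub (normr_real c)) by [].
have dE' : `|d| = rval (RealSub (normr_real d)) by [].
move: (RealSub (normr_real b)) (RealSub (normr_real c)) (RealSub (normr_real d)) bE' cE' dE'.
move=> b' c' d' -> -> -> h0.
set p := (X in 0 <= X); rewrite -[0 <= p]/(0 <= rval p); move: h0; congr (_ <= _).
set q' := (X in X = _).
(* The second summand is the multiple of i^2 + 1 by which the complex expansion differs from the
   real quadratic form. *)
have -> : q' = rval p + ('i ^+ 2 + 1) * rval (- (1 - (b' ^+ 2 + c' ^+ 2 + d' ^+ 2)
  + 2 * (b' * c' * d')) * y ^+ 2 - 2 * (b' - c' * d') * l * y).
  by rewrite /q' /p; ring.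
by rewrite sqrCi addNr mul0r addr0.
Qed.
End CanonicalForm.

(** * Product bases adapted to a maximizing product state *)

Section PureStates.
Variable C : numClosedFieldType.
Implicit Types (a b c : 'cV[C]_2) (u v x y z : C) (psi : 'cV[C]_8).

Lemma tensor_bound (t1 t2 t3 t4 t5 t6 t7 : C) :
  (forall x0 x1 y0 y1 z0 z1,
    `|x0 * y0 * z0 + t1 * x0 * y0 * z1 + t2 * x0 * y1 * z0 + t3 * x0 * y1 * z1
      + t4 * x1 * y0 * z0 + t5 * x1 * y0 * z1 + t6 * x1 * y1 * z0
      + t7 * x1 * y1 * z1| ^+ 2 <=
    (`|x0| ^+ 2 + `|x1| ^+ 2) * (`|y0| ^+ 2 + `|y1| ^+ 2) * (`|z0| ^+ 2 + `|z1| ^+ 2)) ->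
  `|t1| ^+ 2 + `|t2| ^+ 2 + `|t3| ^+ 2 + `|t4| ^+ 2 + `|t5| ^+ 2 + `|t6| ^+ 2
    + `|t7| ^+ 2 <= 5 / 4.
Proof.
move=> H.
(* Stationarity without derivatives: moving one qubit from (1, 0) to (1, t^* ) gives (1 + q)^2 <= 1
   + q with q = |t|^2, which forces t = 0. *)
have stat t : `|1 + t * t^*| ^+ 2 <= 1 + `|t| ^+ 2 -> t = 0.
  rewrite -normCK; set q := `|t| ^+ 2; have q0 : 0 <= q by rewrite exprn_ge0.
  rewrite ger0_norm ?addr_ge0 // => h; apply/eqP.
  have : q <= 0.
    rewrite -subr_ge0 in h; have q2 : 0 <= q ^+ 2 by rewrite exprn_ge0.
    rewrite -oppr_ge0; apply: le_trans (_ : - q - q ^+ 2 <= _); last first.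
      by rewrite lerBlDr lerDl.
    by move: h; congr (_ <= _); ring.
  by move=> q1; rewrite -normr_eq0 -sqrf_eq0 -/q eq_le q0 q1.
have n1 : `|1 : C| ^+ 2 = 1 by rewrite normr1 expr1n.
have n0 : `|0 : C| ^+ 2 = 0 by rewrite normr0 expr0n.
have t10 : t1 = 0.
  apply: stat; have := H 1 0 1 0 1 t1^*.
  by rewrite norm_conjC n1 n0 !(addr0, mulr0, mul0r, mul1r, mulr1).
have t20 : t2 = 0.
  apply: stat; have := H 1 0 1 t2^* 1 0.
  by rewrite norm_conjC n1 n0 !(addr0, mulr0, mul0r, mul1r, mulr1).
have t40 : t4 = 0.
  apply: stat; have := H 1 t4^* 1 0 1 0.
  by rewrite norm_conjC n1 n0 !(addr0, mulr0, mul0r, mul1r, mulr1).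
have := @canonical_form_bound C t3 t5 t6 t7.
rewrite t10 t20 t40 !n0 !(add0r, addr0); apply => x0 x1 y0 y1 z0 z1.
have := H x0 x1 y0 y1 z0 z1.
by rewrite t10 t20 t40 !(mul0r, addr0).
Qed.

Lemma big_ord8 (V : nmodType) (F : 'I_8 -> V) : \sum_i F i =
  F (inord 0) + F (inord 1) + F (inord 2) + F (inord 3) +
  F (inord 4) + F (inord 5) + F (inord 6) + F (inord 7).
Proof.
rewrite !big_ord_recl big_ord0 addr0 !addrA.
by do ![congr (_ + _)]; congr F; apply: val_inj; rewrite /= inordK.
Qed.

Definition ebra a u v := (a 0 0)^* * u + (a 1 0)^* * v.

Lemma braket_prod3 a b c psi : braket (prod3 a b c) psi =
  ebra a (ebra b (ebra c (psi (inord 0) 0) (psi (inord 1) 0))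
                 (ebra c (psi (inord 2) 0) (psi (inord 3) 0)))
         (ebra b (ebra c (psi (inord 4) 0) (psi (inord 5) 0))
                 (ebra c (psi (inord 6) 0) (psi (inord 7) 0))).
Proof.
have i0 : inord 0 = 0 :> 'I_2 by apply: val_inj; rewrite /= inordK.
have i1 : inord 1 = 1 :> 'I_2 by apply: val_inj; rewrite /= inordK.
rewrite /braket big_ord8 !mxE /q1 /q2 /q3 !inordK //= ?i0 ?i1 /ebra !rmorphM /=.
ring.
Qed.

(** For normalized [a], the pair [a], [perp a] is an orthonormal basis of the qubit space. *)
Definition perp a : 'cV[C]_2 := \col_(i < 2) (if i == 0 then - (a 1 0)^* else (a 0 0)^*).

Lemma sqnormE a : braket a a = a 0 0 * (a 0 0)^* + a 1 0 * (a 1 0)^*.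
Proof. by rewrite braket_normsq -[RHS]/(_ + _) -!normCK -!val_normsq. Qed.

Lemma ebra_comb a x0 x1 u v :
  ebra (x0 *: a + x1 *: perp a) u v = x0^* * ebra a u v + x1^* * ebra (perp a) u v.
Proof. by rewrite /ebra !mxE /= !rmorphD !rmorphM /=; ring. Qed.

Lemma ebra_lin a x u v y u' v' :
  ebra a (x * u + y * u') (x * v + y * v') = x * ebra a u v + y * ebra a u' v'.
Proof. by rewrite /ebra; ring. Qed.

Lemma ebra_parseval a u v : normalized a ->
  `|ebra a u v| ^+ 2 + `|ebra (perp a) u v| ^+ 2 = `|u| ^+ 2 + `|v| ^+ 2.
Proof.
rewrite /normalized sqnormE => na; rewrite !normCK.
(* Inserting the factor <a|a> = 1 makes the claim a polynomial identity. *)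
have -> : u * u^* + v * v^* =
    (a 0 0 * (a 0 0)^* + a 1 0 * (a 1 0)^*) * (u * u^* + v * v^*) by rewrite na mul1r.
rewrite /ebra !mxE /= !(rmorphD, rmorphM, rmorphN) /= !conjCK; ring.
Qed.

Lemma sqnorm_comb a x0 x1 : normalized a ->
  braket (x0 *: a + x1 *: perp a) (x0 *: a + x1 *: perp a) = `|x0| ^+ 2 + `|x1| ^+ 2.
Proof.
rewrite /normalized sqnormE => na; rewrite sqnormE !normCK.
have -> : x0 * x0^* + x1 * x1^* =
    (a 0 0 * (a 0 0)^* + a 1 0 * (a 1 0)^*) * (x0 * x0^* + x1 * x1^*) by rewrite na mul1r.
rewrite !mxE /= !(rmorphD, rmorphM, rmorphN) /= !conjCK; ring.
Qed.

Lemma normalizeP a : exists n a', [/\ 0 <= n, normalized a', a = n *: a' & n ^+ 2 = braket a a].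
Proof.
pose m := braket a a; pose n := sqrtC m.
have m0 : 0 <= m by rewrite /m sqnormE -!normCK addr_ge0 ?exprn_ge0.
have [mz|mn] := eqVneq m 0.
  exists 0, (\col_(i < 2) (i == 0)%:R); split=> //; last by rewrite expr0n -/m mz.
    by rewrite /normalized sqnormE !mxE /= conjC1 conjC0 mulr1 mulr0 addr0.
  move/eqP: mz; rewrite /m sqnormE -!normCK paddr_eq0 ?exprn_ge0 // !sqrf_eq0 !normr_eq0.
  move=> /andP[/eqP a0 /eqP a1]; rewrite scale0r; apply/colP=> -[[|[|//]] i2];
    rewrite mxE; [rewrite -[RHS]a0 | rewrite -[RHS]a1]; congr (a _ _); exact: val_inj.
have n0 : n != 0 by rewrite sqrtC_eq0.
have nn : 0 <= n by rewrite sqrtC_ge0.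
exists n, (n^-1 *: a); split=> //; last by rewrite sqrtCK.
  rewrite /normalized sqnormE !mxE !rmorphM /= fmorphV /= (geC0_conj nn).
  rewrite (_ : _ + _ = n^-1 ^+ 2 * braket a a); last by rewrite sqnormE; ring.
  by rewrite -/m exprVn -[m in _ * m]sqrtCK mulVf ?sqrf_eq0.
by rewrite scalerA mulfV ?scale1r.
Qed.

Lemma overlapZ psi x y z a b c :
  overlap psi (x *: a) (y *: b) (z *: c) = `|x| * `|y| * `|z| * overlap psi a b c.
Proof.
rewrite /overlap !braket_prod3 -!(norm_conjC x, norm_conjC y, norm_conjC z) -!normrM.
by congr (`|_|); rewrite /ebra !mxE !rmorphM /=; ring.
Qed.

(** The overlap is absolutely homogeneous in each factor, so the maximum over unit vectors bounds it
    on all vectors. *)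
Lemma overlap_le psi g : IsG psi g -> 0 <= g /\
  forall a b c, overlap psi a b c ^+ 2 <= g ^+ 2 * (braket a a * braket b b * braket c c).
Proof.
move=> [[a0 [b0 [c0 [_ _ _ og]]]] gmax].
have g0 : 0 <= g by rewrite -og normr_ge0.
split=> // a b c.
have [x [a' [x0 na -> <-]]] := normalizeP a.
have [y [b' [y0 nb -> <-]]] := normalizeP b.
have [z [c' [z0 nc -> <-]]] := normalizeP c.
have o0 : 0 <= overlap psi a' b' c' by exact: normr_ge0.
have xyz0 : 0 <= x * y * z by rewrite !mulr_ge0.
rewrite overlapZ !ger0_norm // -!exprMn [g * _]mulrC.
by apply: lerXn2r; rewrite ?nnegrE ?mulr_ge0 // ler_wpM2l // gmax.
Qed.

Lemma braket8 psi : braket psi psi =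
  `|psi (inord 0) 0| ^+ 2 + `|psi (inord 1) 0| ^+ 2 +
  `|psi (inord 2) 0| ^+ 2 + `|psi (inord 3) 0| ^+ 2 +
  `|psi (inord 4) 0| ^+ 2 + `|psi (inord 5) 0| ^+ 2 +
  `|psi (inord 6) 0| ^+ 2 + `|psi (inord 7) 0| ^+ 2.
Proof. by rewrite /braket; under eq_bigr do rewrite -normCKC; rewrite big_ord8. Qed.

Lemma prod3_parseval a b c psi : normalized a -> normalized b -> normalized c ->
  braket psi psi =
  overlap psi a b c ^+ 2 + overlap psi a b (perp c) ^+ 2 +
  overlap psi a (perp b) c ^+ 2 + overlap psi a (perp b) (perp c) ^+ 2 +
  overlap psi (perp a) b c ^+ 2 + overlap psi (perp a) b (perp c) ^+ 2 +
  overlap psi (perp a) (perp b) c ^+ 2 + overlap psi (perp a) (perp b) (perp c) ^+ 2.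
Proof.
move=> na nb nc; rewrite /overlap !braket_prod3 braket8.
have P d u v : normalized d ->
    `|ebra (perp d) u v| ^+ 2 = `|u| ^+ 2 + `|v| ^+ 2 - `|ebra d u v| ^+ 2.
  by move=> /(ebra_parseval u v) <-; rewrite addrC addKr.
rewrite !(P a) // !(P b) // !(P c) //; ring.
Qed.

(** In the product basis built on a maximizer, all coefficients are divided by the leading one, of
    modulus g. Then [tensor_bound] and Parseval give 1 - g^2 <= 5/4 g^2. *)
Theorem G_lower_bound psi g : normalized psi -> IsG psi g -> 4 / 9 <= g ^+ 2.
Proof.
move=> npsi Gg; have [g0 gle] := overlap_le Gg.
have [[a [b [c [na nb nc og]]]] _] := Gg.
pose t (i j k : bool) := braket (prod3 (if i then perp a else a)
  (if j then perp b else b) (if k then perp c else c)) psi.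
have tg : `|t false false false| = g by [].
pose t0 := t false false false.
have F x0 x1 y0 y1 z0 z1 :
  `|(x0 * y0 * z0 * t false false false + x0 * y0 * z1 * t false false true +
    x0 * y1 * z0 * t false true false + x0 * y1 * z1 * t false true true +
    x1 * y0 * z0 * t true false false + x1 * y0 * z1 * t true false true +
    x1 * y1 * z0 * t true true false + x1 * y1 * z1 * t true true true)| ^+ 2 <=
  g ^+ 2 * ((`|x0| ^+ 2 + `|x1| ^+ 2) * (`|y0| ^+ 2 + `|y1| ^+ 2) * (`|z0| ^+ 2 + `|z1| ^+ 2)).
  have := gle (x0^* *: a + x1^* *: perp a) (y0^* *: b + y1^* *: perp b)
    (z0^* *: c + z1^* *: perp c).
  rewrite !sqnorm_comb // !norm_conjC; congr (_ <= _).
  rewrite /overlap /t !braket_prod3; congr (`|_| ^+ 2).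
  by rewrite !(ebra_comb, ebra_lin) !conjCK; ring.
have gn0 : g != 0.
  apply/eqP => gz; have := prod3_parseval psi na nb nc.
  have oz a' b' c' : overlap psi a' b' c' ^+ 2 = 0.
    apply/eqP; rewrite eq_le exprn_ge0 ?normr_ge0 // andbT.
    by have := gle a' b' c'; rewrite gz expr0n mul0r.
  by rewrite npsi !oz !addr0 => /eqP; rewrite oner_eq0.
have t0n : t0 != 0 by rewrite -normr_eq0 tg.
have gg0 : 0 < g ^+ 2 by rewrite lt0r exprn_ge0 // expf_neq0.
lapply (@tensor_bound (t false false true / t0) (t false true false / t0)
  (t false true true / t0) (t true false false / t0) (t true false true / t0)
  (t true true false / t0) (t true true true / t0)); last first.
  move=> x0 x1 y0 y1 z0 z1.
  rewrite -(ler_pM2l gg0); apply: le_trans (F x0 x1 y0 y1 z0 z1).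
  rewrite -tg -exprMn -normrM le_eqVlt; apply/orP; left; apply/eqP; congr (`|_| ^+ 2).
  by rewrite -/t0; field.
rewrite !normf_div -/t0 tg !expr_div_n -!mulrDl ler_pdivrMr // => h.
have := prod3_parseval psi na nb nc; rewrite npsi.
rewrite -[overlap psi a b c]/`|t0| tg => P.
have {}h : 1 - g ^+ 2 <= 5 / 4 * g ^+ 2.
  apply: le_trans h; rewrite P le_eqVlt; apply/orP; left; apply/eqP.
  rewrite /overlap /t; ring.
rewrite -subr_ge0 in h; rewrite -subr_ge0.
have -> : g ^+ 2 - 4 / 9 = 4 / 9 * (5 / 4 * g ^+ 2 - (1 - g ^+ 2)) by field.
by rewrite mulr_ge0 ?divr_ge0 ?ler0n.
Qed.
End PureStates.

(** * The W state and mixed states *)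

Section WState.
Variable C : numClosedFieldType.
Implicit Types (a b c : 'cV[C]_2) (psi u v w : 'cV[C]_8).

(* Writing the first two terms as q z, q is a sine and r the cosine of the sum
   of the angles of (x, x') and (y, y'), and s the cosine of their difference. *)
Lemma W_real_bound (R : realFieldType) (x y z x' y' z' : R) :
  x ^+ 2 + x' ^+ 2 = 1 -> y ^+ 2 + y' ^+ 2 = 1 -> z ^+ 2 + z' ^+ 2 = 1 ->
  (x' * y * z + x * y' * z + x * y * z') ^+ 2 <= 4 / 3.
Proof.
move=> nx ny nz.
pose r := x * y - x' * y'; pose s := x * y + x' * y'; pose q := x' * y + x * y'.
have qr : q ^+ 2 + r ^+ 2 = 1.
  transitivity ((x ^+ 2 + x' ^+ 2) * (y ^+ 2 + y' ^+ 2)).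
    by rewrite /q /r; ring.
  by rewrite nx ny mulr1.
have s1 : s ^+ 2 <= 1.
  have <- : s ^+ 2 + (x * y' - x' * y) ^+ 2 = 1.
    transitivity ((x ^+ 2 + x' ^+ 2) * (y ^+ 2 + y' ^+ 2)).
      by rewrite /s; ring.
    by rewrite nx ny mulr1.
  by rewrite lerDl sqr_ge0.
have cs : (x' * y * z + x * y' * z + x * y * z') ^+ 2 <= q ^+ 2 + (x * y) ^+ 2.
  rewrite -[X in _ <= X]mulr1 -nz -subr_ge0.
  rewrite (_ : _ - _ = (q * z' - x * y * z) ^+ 2) ?sqr_ge0 // /q; ring.
have xy : x * y = (r + s) / 2 by rewrite /r /s; field.
(* Here q^2 + (x y)^2 = 1 + s^2 / 3 - (3 r - s)^2 / 12, and s^2 <= 1. *)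
have := sqr_ge0 (3 * r - s).
move: cs; rewrite xy; lra.
Qed.

Lemma Wcoef k : (k < 8)%N -> Wstate C (inord k) 0 =
  if [|| k == 4%N, k == 2%N | k == 1%N] then (sqrtC 3)^-1 else 0.
Proof. by move=> k8; rewrite mxE /= inordK // orbA. Qed.

Lemma sqrtC3V : (sqrtC 3)^-1 ^+ 2 = 3^-1 :> C.
Proof. by rewrite exprVn sqrtCK. Qed.

Lemma W_braket a b c : braket (prod3 a b c) (Wstate C) =
  (sqrtC 3)^-1 * (a 1 0 * b 0 0 * c 0 0 + a 0 0 * b 1 0 * c 0 0 + a 0 0 * b 0 0 * c 1 0)^*.
Proof.
by rewrite braket_prod3 !Wcoef //= /ebra !(rmorphD, rmorphM) /=; ring.
Qed.

Lemma W_overlap_le a b c : normalized a -> normalized b -> normalized c ->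
  overlap (Wstate C) a b c <= 2 / 3.
Proof.
move=> na nb nc; rewrite /overlap W_braket normrM norm_conjC.
have w0 : 0 <= (sqrtC 3)^-1 :> C by rewrite invr_ge0 sqrtC_ge0 ler0n.
have r0 : 0 <= 2 / 3 :> C by rewrite divr_ge0 ?ler0n.
rewrite ger0_norm // -ler_sqr ?nnegrE //; last exact: mulr_ge0.
rewrite exprMn sqrtC3V.
have nsq (d : 'cV[C]_2) : normalized d ->
    RealSub (normr_real (d 0 0)) ^+ 2 + RealSub (normr_real (d 1 0)) ^+ 2 = 1.
  rewrite /normalized sqnormE -!normCK => nd; apply: val_inj.
  exact: nd.
have le := W_real_bound (nsq a na) (nsq b nb) (nsq c nc).
have v43 : rval (4 / 3 : realsub C) = 4 / 3 by rewrite fmorph_div !rmorph_nat.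
have {le} : (`|a 1 0| * `|b 0 0| * `|c 0 0| + `|a 0 0| * `|b 1 0| * `|c 0 0|
    + `|a 0 0| * `|b 0 0| * `|c 1 0|) ^+ 2 <= 4 / 3 by rewrite -v43; exact: le.
rewrite -!normrM => le.
have tri : `|a 1 0 * b 0 0 * c 0 0 + a 0 0 * b 1 0 * c 0 0 + a 0 0 * b 0 0 * c 1 0| <=
   `|a 1 0 * b 0 0 * c 0 0| + `|a 0 0 * b 1 0 * c 0 0| + `|a 0 0 * b 0 0 * c 1 0|.
  by apply: le_trans (ler_normD _ _) _; rewrite lerD2r ler_normD.
have -> : (2 / 3) ^+ 2 = 3^-1 * (4 / 3) :> C by field.
rewrite ler_pM2l ?invr_gt0 ?ltr0n //; apply: le_trans le.
by apply: lerXn2r; rewrite ?nnegrE ?addr_ge0.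
Qed.

Lemma W_IsG : IsG (Wstate C) (2 / 3).
Proof.
split; last exact: W_overlap_le.
(* A symmetric maximizer, with weights 2/3 on |0> and 1/3 on |1> in every qubit. *)
pose a : 'cV[C]_2 := \col_(i < 2) (if i == 0 then sqrtC (2 / 3) else (sqrtC 3)^-1).
have w0 : 0 <= (sqrtC 3)^-1 :> C by rewrite invr_ge0 sqrtC_ge0 ler0n.
have s0 : 0 <= sqrtC (2 / 3) :> C by rewrite sqrtC_ge0 divr_ge0 ?ler0n.
have na : normalized a.
  rewrite /normalized sqnormE !mxE /= (geC0_conj s0) (geC0_conj w0).
  by rewrite -!expr2 sqrtC3V sqrtCK; field.
exists a, a, a; split=> //; rewrite /overlap W_braket !mxE /=.
set p := sqrtC (2 / 3); set q := (sqrtC 3)^-1.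
have -> : q * p * p + p * q * p + p * p * q = 3 * p ^+ 2 * q by ring.
rewrite normrM norm_conjC !normrM !ger0_norm // ?ler0n //.
rewrite (_ : q * _ = 3 * p ^+ 2 * q ^+ 2); last by ring.
by rewrite sqrtCK sqrtC3V; field.
Qed.

Lemma braketC n (u v : 'cV[C]_n) : (braket u v)^* = braket v u.
Proof.
by rewrite /braket rmorph_sum; apply: eq_bigr => i _; rewrite rmorphM /= conjCK mulrC.
Qed.

Lemma braketZ n (u v : 'cV[C]_n) x : braket u (x *: v) = x * braket u v.
Proof.
by rewrite /braket mulr_sumr; apply: eq_bigr => k _; rewrite mxE mulrCA.
Qed.

Lemma braketB n (u v w : 'cV[C]_n) x : braket u (v - x *: w) = braket u v - x * braket u w.
Proof.
rewrite /braket mulr_sumr -sumrB; apply: eq_bigr => i _.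
by rewrite !mxE mulrBr mulrCA.
Qed.

Lemma braket_eq0 n (u : 'cV[C]_n) : braket u u = 0 -> u = 0.
Proof.
rewrite /braket => h; apply/colP => i; rewrite mxE.
have /eqP := h; rewrite psumr_eq0 => [/allP/(_ i)|j _]; last by rewrite -normCKC exprn_ge0.
by rewrite mem_index_enum /= -normCKC sqrf_eq0 normr_eq0 => /(_ isT)/eqP.
Qed.

Lemma adjmx_mul n (u v : 'cV[C]_n) : adjmx u *m v = (braket u v)%:M.
Proof.
apply/matrixP=> i j; rewrite !ord1 [RHS]mxE eqxx mulr1n mxE.
by apply: eq_bigr => k _; rewrite !mxE.
Qed.

Lemma proj_form u v : (adjmx v *m proj u *m v) 0 0 = `|braket v u| ^+ 2.
Proof.
rewrite /proj !mulmxA adjmx_mul -mulmxA adjmx_mul -scalar_mxM mxE eqxx mulr1n.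
by rewrite normCK braketC.
Qed.

Lemma W_normalized : normalized (Wstate C).
Proof.
rewrite /normalized braket8 !Wcoef //= normr0 expr0n /=.
rewrite ger0_norm ?sqrtC3V; first by field.
by rewrite invr_ge0 sqrtC_ge0 ler0n.
Qed.

(** The part [v] of [psi i] orthogonal to [u] satisfies <v|u> = 0, so the nonnegative terms p_j
    |<v|psi_j>|^2 sum to 0. As p_i is nonzero, <v|psi_i> = <v|v> vanishes. *)
Lemma decomp_proj u n (p : 'I_n -> C) (psi : 'I_n -> 'cV[C]_8) i :
  normalized u -> IsDecomp (proj u) p psi -> p i != 0 ->
  exists2 x, `|x| = 1 & psi i = x *: u.
Proof.
move=> nu [p0 _ npsi pE] pi; pose x := braket u (psi i).
pose v := psi i - x *: u.
have vu : braket v u = 0.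
  by rewrite -braketC braketB -/x nu mulr1 subrr conjC0.
have : \sum_j p j * `|braket v (psi j)| ^+ 2 = 0.
  transitivity ((adjmx v *m proj u *m v) 0 0); last by rewrite proj_form vu normr0 expr0n.
  rewrite pE mulmx_sumr mulmx_suml summxE; apply: eq_bigr => j _.
  by rewrite -scalemxAr -scalemxAl mxE proj_form.
move/eqP; rewrite psumr_eq0 => [/allP/(_ i)|j _]; last by rewrite mulr_ge0 ?exprn_ge0.
rewrite mem_index_enum => /(_ isT) /=.
rewrite mulf_eq0 (negPf pi) sqrf_eq0 normr_eq0 => /eqP vpsi.
have v0 : v = 0 by apply: braket_eq0; rewrite {2}/v braketB vpsi vu mulr0 subrr.
have psiE : psi i = x *: u by apply/eqP; rewrite -subr_eq0 -/v v0.
exists x => //; apply/eqP; rewrite -(@pexpr_eq1 _ _ 2) // normCK.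
have := npsi i; rewrite /normalized psiE.
by rewrite braketZ -braketC braketZ nu mulr1 => ->.
Qed.

Lemma W_IsEG : IsEG (proj (Wstate C)) (5 / 9).
Proof.
split.
  exists 1%N, (fun=> 1), (fun=> Wstate C), (fun=> 2 / 3); split.
  - by split=> *; rewrite ?big_ord1 ?scale1r ?ler01 //; exact: W_normalized.
  - by move=> i; exact: W_IsG.
  - by rewrite big_ord1 mul1r /EGpure_val; field.
move=> e' [n [p [psi [g [dec Gg ->]]]]].
have [p0 p1 _ _] := dec.
have -> : 5 / 9 = \sum_i p i * (5 / 9) by rewrite -mulr_suml p1 mul1r.
apply: ler_sum => i _.
have [->|pi] := eqVneq (p i) 0; first by rewrite !mul0r.
rewrite ler_wpM2l // /EGpure_val.
have [x x1 psiE] := decomp_proj W_normalized dec pi.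
have [[a [b [c [na nb nc gE]]]] _] := Gg i.
have g23 : g i <= 2 / 3.
  rewrite -gE psiE /overlap braketZ.
  by rewrite normrM x1 mul1r; exact: W_overlap_le.
have g0 : 0 <= g i by rewrite -gE normr_ge0.
have : g i ^+ 2 <= (2 / 3) ^+ 2.
  by apply: lerXn2r => //; rewrite nnegrE // divr_ge0 ?ler0n.
move=> h; rewrite -subr_ge0.
have -> : 1 - g i ^+ 2 - 5 / 9 = (2 / 3) ^+ 2 - g i ^+ 2 by field.
by rewrite subr_ge0.
Qed.
End WState.

(** * Spectral decomposition of density matrices *)

Section Mixed.
Variable C : numClosedFieldType.
Implicit Types (u v w : 'cV[C]_8) (rho : 'M[C]_8).

(** Polarization: the form is real on u + v and on u + i v, which determines the real and imaginary
    relations between [B u v] and [B v u]. *)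
Lemma density_hermitian rho : density rho -> adjmx rho = rho.
Proof.
move=> [pos _].
pose B u v := (adjmx u *m rho *m v) 0 0.
have Bd (i j : 'I_8) : B (delta_mx i 0) (delta_mx j 0) = rho i j.
  rewrite /B (_ : adjmx _ = delta_mx 0 i) -?rowE -?colE ?mxE //.
  by apply/matrixP=> k l; rewrite !mxE andbC; case: (_ && _); rewrite ?conjC1 ?conjC0.
have BD z u v : B (u + z *: v) (u + z *: v) =
    B u u + z * B u v + z^* * B v u + z * z^* * B v v.
  rewrite /B (_ : adjmx (u + z *: v) = adjmx u + z^* *: adjmx v); last first.
    by apply/matrixP=> k l; rewrite !mxE rmorphD rmorphM.
  rewrite !mulmxDl !mulmxDr -!scalemxAl -!scalemxAr !mxE; ring.
have Breal u : (B u u)^* = B u u by rewrite geC0_conj // pos.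
apply/matrixP=> i j; rewrite !mxE -!Bd.
move: (delta_mx i 0) (delta_mx j 0) => u v.
have e1 := Breal (u + 1 *: v); have e2 := Breal (u + 'i *: v).
rewrite !BD !(rmorphD, rmorphM) /= conjCK !Breal conjC1 in e1.
rewrite !BD !(rmorphD, rmorphM) /= conjCK !Breal conjCi in e2.
have {}e1 : (B u v)^* + (B v u)^* = B u v + B v u.
  by apply: (addrI (B u u + B v v)); move: e1; congr (_ = _); ring.
have {}e2 : (B v u)^* - (B u v)^* = B u v - B v u.
  apply: (mulfI (neq0Ci C)); apply: (addrI (B u u - 'i ^+ 2 * B v v)).
  by move: e2; congr (_ = _); ring.
have n2 : 2 != 0 :> C by rewrite pnatr_eq0.
apply: (mulfI n2).
have -> : 2 * (B v u)^* = ((B u v)^* + (B v u)^*) + ((B v u)^* - (B u v)^*) by ring.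
by rewrite e1 e2; ring.
Qed.

Lemma density_decomp rho : density rho -> exists (p : 'I_8 -> C) psi, IsDecomp rho p psi.
Proof.
move=> drho; have [pos tr1] := drho.
pose P := spectralmx rho; pose D := spectral_diag rho.
have adjE m n (A : 'M[C]_(m, n)) : map_mx Num.conj A^T = adjmx A.
  by apply/matrixP=> i j; rewrite !mxE.
have Pu := spectral_unitarymx rho; rewrite -/P in Pu.
have PV : P *m adjmx P = 1%:M by rewrite -adjE; exact/unitarymxP.
have rhoE : rho = adjmx P *m diag_mx D *m P.
  rewrite -adjE -(invmx_unitary Pu).
  by apply/orthomx_spectralP/normalmxP; rewrite !adjE density_hermitian.
(* From rho = P^* D P, the eigenvectors are the conjugated rows of [P]; each eigenvalue is the value
   of the form at its eigenvector, hence nonnegative. *)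
pose psi (k : 'I_8) : 'cV[C]_8 := adjmx (row k P).
have adj_psi k : adjmx (psi k) = row k P.
  by apply/matrixP=> i j; rewrite !mxE conjCK.
have DE k : D 0 k = (adjmx (psi k) *m rho *m psi k) 0 0.
  have Prow : row k P *m adjmx P = delta_mx 0 k by rewrite -row_mul PV row1.
  have Pcol : P *m psi k = delta_mx k 0.
    have -> : psi k = adjmx P *m delta_mx k 0.
      by rewrite -colE; apply/matrixP=> i j; rewrite !mxE.
    by rewrite mulmxA PV mul1mx.
  by rewrite adj_psi rhoE !mulmxA Prow -mulmxA Pcol -rowE -colE !mxE eqxx mulr1n.
exists (D 0), psi; split.
- by move=> k; rewrite DE; exact: pos.
- by rewrite -mxtrace_diag -tr1 rhoE -mulmxA mxtrace_mulC -mulmxA PV mulmx1.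
- move=> k; transitivity ((P *m adjmx P) k k); last by rewrite PV mxE eqxx.
  rewrite /braket [RHS]mxE; apply: eq_bigr => i _.
  by rewrite !mxE conjCK.
- rewrite rhoE; apply/matrixP=> i j; rewrite summxE mxE; apply: eq_bigr => k _.
  by rewrite mul_mx_diag /proj adj_psi !mxE big_ord1 !mxE mulrAC mulrC mulrA.
Qed.
End Mixed.

(** The convex roof is a minimum, so for mixed states a single decomposition of value at most 5/9
    suffices. The spectral one has this property, because each of its pure states has g^2 >= 4/9. *)
Theorem theorem2 (C : numClosedFieldType) :
  IsEG (proj (Wstate C)) (5 / 9) /\
  (forall rho : 'M[C]_8, density rho ->
     exists e, DecompValue rho e /\ e <= 5 / 9).
Proof.
split=> [|rho /density_decomp[p [psi dec]]]; first exact: W_IsEG.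
have [g Gg] := fin_all_exists (fun i => IsG_exists (psi i)).
have [p0 p1 npsi _] := dec.
exists (\sum_i p i * EGpure_val (g i)); split; first by exists 8%N, p, psi, g.
have -> : 5 / 9 = \sum_i p i * (5 / 9) :> C by rewrite -mulr_suml p1 mul1r.
apply: ler_sum => i _; apply: ler_wpM2l (p0 i) _ _ _; rewrite /EGpure_val.
have := G_lower_bound (npsi i) (Gg i) => h; rewrite -subr_ge0.
have -> : 5 / 9 - (1 - g i ^+ 2) = g i ^+ 2 - 4 / 9 by field.
by rewrite subr_ge0.
Qed.
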